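(* There exist absolute constants $C>1$ and $c>0$ such that the following holds. Consider the SSBM in the context with $\eta\in[0,1/2)$, $k\ge2$, $n\ge10$, suppose $\sqrt\rho>1-\frac{1}{4k(2+\sqrt k)}$, and let $\delta\in(0,\frac12)$, $r\ge1$ with $$p>\left(\frac{2kC_4}{\delta(1-2\eta)}\right)^8\frac2n,\qquad C_4=128Cr^2+1.$$ If the regularization parameters $\gamma^+,\gamma^-\ge0$ satisfy $\gamma:=\gamma^++\gamma^-=\bar d^{7/8}$, then with probability at least $1-7e^{-2r}-\frac2n-ne^{-np/c}$ there exists an orthogonal matrix $O\in\mathbb R^{(k-1)\times(k-1)}$ with $$\|V_{k-1}(L_\gamma)-\Theta R_{k-1}O\|\le2\delta.$$
   Context: SSBM: integers $n\ge2,k\ge2$, $p\in(0,1]$, $\eta\in[0,1/2)$, partition of $[n]$ into nonempty clusters $C_1,\dots,C_k$, $|C_i|=n_i$. Independently for each unordered pair $j\ne j'$ an edge is present w.p. $p$, signed $+1$ if $j,j'$ in the same cluster and $-1$ otherwise, then the sign flipped independently w.p. $\eta$. $A$ symmetric signed adjacency (zero diagonal), $A^\pm=\max(\pm A,0)$, $\bar D=\mathrm{diag}((A^++A^-)\mathbf1)$, $\bar d=p(n-1)$. $s=\min n_i/n$, $l=\max n_i/n$, $\rho=s/l$. $\Theta_{ji}=1/\sqrt{n_i}$ if $j\in C_i$ else 0. Regularized Laplacian: $A_\gamma=A+\frac{\gamma^+-\gamma^-}{n}\mathbf1\mathbf1^\top$, $\bar D_\gamma=\bar D+\gamma I$, $L_\gamma=I-\bar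 D_\gamma^{-1/2}A_\gamma\bar D_\gamma^{-1/2}$. $V_{k-1}(M)$: $n\times(k-1)$ matrix of orthonormal eigenvectors for the $k-1$ smallest eigenvalues. With $\bar\alpha=1+\frac p{\bar d}(1-2\eta)$, $\bar C=\bar\alpha I_k-\bar B$, $\bar B_{ii}=\frac{n_ip}{\bar d}(1-2\eta)$, $\bar B_{ii'}=-\frac{\sqrt{n_in_{i'}}p}{\bar d}(1-2\eta)$ ($i\ne i'$); $R_{k-1}\in\mathbb R^{k\times(k-1)}$ has as columns orthonormal eigenvectors of the $k-1$ smallest eigenvalues of $\bar C$. *)

(* Defs.v *)
From HB Require Import structures.
From mathcomp Require Import all_boot all_order all_algebra.
From mathcomp Require Import all_classical all_reals.
From mathcomp Require Import sequences exp Rstruct Rstruct_topology.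
Set Implicit Arguments. Unset Strict Implicit. Unset Printing Implicit Defensive.
Import Order.TTheory GRing.Theory Num.Theory.
Local Open Scope ring_scope.

Notation R := Rdefinitions.R.

Definition euclid (m : nat) (x : 'cV[R]_m) : R := Num.sqrt (\sum_(i < m) x i 0 ^+ 2).

Definition opnorm_le (m q : nat) (X : 'M[R]_(m, q)) (t : R) : Prop :=
  forall x : 'cV[R]_q, euclid (X *m x) <= t * euclid x.

Definition orthogonal_mx (m : nat) (O : 'M[R]_m) : Prop := O^T *m O = 1%:M.

Definition bottom_eigvecs (N m : nat) (M : 'M[R]_N) (V : 'M[R]_(N, m)) : Prop :=
  V^T *m V = 1%:M /\
  exists (U : 'M[R]_N) (lam : 'rV[R]_N),
    U^T *m U = 1%:M /\ M = U *m diag_mx lam *m U^T /\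
    (forall i j : 'I_N, (i <= j)%N -> lam 0 i <= lam 0 j) /\
    (forall (a : 'I_N) (j : 'I_m) (j' : 'I_N), (j : nat) = j' -> V a j = U a j').

Section SSBM.
Variables (n k : nat) (cl : 'I_n -> 'I_k) (p eta : R).

Definition csize (i : 'I_k) : nat := #|[set j | cl j == i]|.

(* sample space: encodings of signed adjacency matrices,
   0 = no edge, 1 = edge with sign +1, 2 = edge with sign -1 *)
Definition sample := 'M['I_3]_n.

Definition sign_of (e : 'I_3) : R :=
  if (e : nat) == 0%N then 0 else if (e : nat) == 1%N then 1 else -1.

Definition valid (a : sample) : bool :=
  [forall i, forall j, a i j == a j i] && [forall i, (a i i : nat) == 0%N].

Definition pair_prob (i j : 'I_n) (e : 'I_3) : R :=
  if (e : nat) == 0%N then 1 - p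
  else if (cl i == cl j) == ((e : nat) == 1%N) then p * (1 - eta) else p * eta.

Definition weight (a : sample) : R :=
  if valid a then \prod_(i : 'I_n) \prod_(j : 'I_n | (i < j)%N) pair_prob i j (a i j)
  else 0.

Definition Prob (E : sample -> Prop) : R :=
  \sum_(a : sample | `[< E a >]) weight a.

Definition Amx (a : sample) : 'M[R]_n := \matrix_(i, j) sign_of (a i j).
Definition deg (a : sample) (i : 'I_n) : R := \sum_j `|Amx a i j|.
Definition dbar : R := p * (n.-1)%:R.

Definition Lgam (gp gm : R) (a : sample) : 'M[R]_n :=
  let g := gp + gm in
  let Ag := Amx a + ((gp - gm) / n%:R) *: const_mx 1 in
  let Dh := diag_mx (\row_i (Num.sqrt (deg a i + g))^-1) in
  1%:M - Dh *m Ag *m Dh.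

Definition Theta : 'M[R]_(n, k) :=
  \matrix_(j, i) (if cl j == i then (Num.sqrt (csize i)%:R)^-1 else 0).

Definition alphabar : R := 1 + p / dbar * (1 - 2 * eta).
Definition Bbar : 'M[R]_k :=
  \matrix_(i, i') (if i == i' then (csize i)%:R * p / dbar * (1 - 2 * eta)
                   else - Num.sqrt ((csize i)%:R * (csize i')%:R) * p / dbar * (1 - 2 * eta)).
Definition Cbar : 'M[R]_k := alphabar%:M - Bbar.

Definition smin : R := (\big[minn/n]_(i < k) csize i)%:R / n%:R.
Definition lmax : R := (\max_(i < k) csize i)%:R / n%:R.
Definition rho : R := smin / lmax.
End SSBM.

(* Main.v *)
Require Import Defs.
From HB Require Import structures.
From mathcomp Require Import all_boot all_order all_algebra.
From mathcomp Require Import all_classical all_reals.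
From mathcomp Require Import sequences exp Rstruct Rstruct_topology.
From mathcomp Require Import ring lra zify.
From mathcomp Require Import spectral complex.
Set Implicit Arguments. Unset Strict Implicit. Unset Printing Implicit Defensive.
Import Order.TTheory GRing.Theory Num.Theory.
Local Open Scope ring_scope.

(** Write [d = dbar], [t = d ^ (1/8)], so that [gamma = t ^ 7].  The Laplacian is
compared with [Lbar = I - E A / d = alphabar I - Theta Bbar Theta^T], whose
[k - 1] smallest eigenvectors are [Theta R] and whose next eigenvalue is larger
by at least [(1 - 2 eta) / (2 k)].  By Davis-Kahan it suffices that
[|L_gamma - Lbar| <= K / t] with [K] absolute.

Outside an event of probability [n exp (- n p / 16)], the centered matrices
[A - E A] and [|A| - E |A|] have norm at most [208 t ^ 7] and all degrees lie
between [d / 4] and [4 d].  The second norm bound also controls the degrees in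
mean square, which is enough to replace [D_gamma] by [d] in front of the
delocalized matrix [E A].

For the norm bound, a bilinear form [x^T W y] is maximized over vectors of
[n ^ (-1/2) Z ^ n] of norm at most 2, of which there are at most [exp (6 n)].
Pairs with [|x_i y_j| <= t ^ 7 / n] are handled by a Chernoff bound and a union
bound.  Among the other pairs, those with [|x_i / y_j|] outside [(1/t, t)] are
controlled by the degrees; the remaining ones live on at most [8 n / t ^ 6]
vertices, and such a vertex set [S] spans at most [t ^ 6 |S|] edges, so its graph
is [2 t ^ 6]-degenerate. *)

(** * Euclidean norm and operator norm *)

(** The probability bound is informative only once [d] is of order log n at least. In the sparsest
    such regime a single degree is off by [t ^ 7] with probability about exp(- t ^ 6), too much for
    a union bound over vertices, so the difference between the inverse square roots of [D_gamma] and
    [d] cannot be controlled uniformly. It is therefore only ever multiplied with [E A], whose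
    entries are at most [p]: a Frobenius estimate then asks for no more than the mean square of the
    degree deviations, and these deviations are the image of the all-ones vector under
    [|A| - E |A|].

    The scale [t ^ 7] is dictated by the target: divided by degrees of order [t ^ 8], both noise and
    regularization leave [1 / t]. It lies far above the true noise level [t ^ 4], the square root of
    [d], and this slack is what lets crude numerical constants and a coarse integer grid suffice. *)

Definition dot (m : nat) (x y : 'cV[R]_m) : R := (x^T *m y) 0 0.
Definition nsq (m : nat) (x : 'cV[R]_m) : R := dot x x.

Section Dot.
Variable m : nat.
Implicit Types x y z : 'cV[R]_m.

Lemma dotE x y : dot x y = \sum_i x i 0 * y i 0.
Proof. by rewrite /dot mxE; apply: eq_bigr => i _; rewrite mxE. Qed.

Lemma dotC x y : dot x y = dot y x.
Proof. by rewrite !dotE; apply: eq_bigr => i _; rewrite mulrC. Qed.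

Lemma dotDl x y z : dot (x + y) z = dot x z + dot y z.
Proof. by rewrite /dot linearD mulmxDl mxE. Qed.

Lemma dotDr x y z : dot z (x + y) = dot z x + dot z y.
Proof. by rewrite /dot mulmxDr mxE. Qed.

Lemma dotZl c x z : dot (c *: x) z = c * dot x z.
Proof. by rewrite /dot linearZ -scalemxAl mxE. Qed.

Lemma dotZr c x z : dot z (c *: x) = c * dot z x.
Proof. by rewrite dotC dotZl dotC. Qed.

Lemma dotBr x y z : dot z (x - y) = dot z x - dot z y.
Proof. by rewrite dotDr -scaleN1r dotZr mulN1r. Qed.

Lemma nsqE x : nsq x = \sum_i x i 0 ^+ 2.
Proof. by rewrite /nsq dotE; apply: eq_bigr => i _; rewrite expr2. Qed.

Lemma nsq_ge0 x : 0 <= nsq x.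
Proof. by rewrite nsqE sumr_ge0 // => i _; rewrite sqr_ge0. Qed.

Lemma nsq_eq0 x : (nsq x == 0) = (x == 0).
Proof.
apply/idP/eqP => [|->]; last by rewrite /nsq /dot mulmx0 mxE.
rewrite nsqE psumr_eq0 => [/allP h|i _]; last exact: sqr_ge0.
apply/colP => i; rewrite mxE.
by have := h i (mem_index_enum _); rewrite sqrf_eq0 => /eqP.
Qed.

Lemma nsqZ c x : nsq (c *: x) = c ^+ 2 * nsq x.
Proof. by rewrite /nsq dotZl dotZr mulrA expr2. Qed.

Lemma nsqD x y : nsq (x + y) = nsq x + 2 * dot x y + nsq y.
Proof. rewrite /nsq dotDl !dotDr (dotC y x); ring. Qed.

Lemma euclidE x : euclid x = Num.sqrt (nsq x).
Proof. by rewrite nsqE. Qed.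

Lemma euclid_ge0 x : 0 <= euclid x.
Proof. exact: sqrtr_ge0. Qed.

Lemma sqr_euclid x : euclid x ^+ 2 = nsq x.
Proof. by rewrite euclidE sqr_sqrtr // nsq_ge0. Qed.

Lemma euclid_gt0 x : x != 0 -> 0 < euclid x.
Proof. by move=> x0; rewrite euclidE sqrtr_gt0 lt_neqAle nsq_ge0 eq_sym nsq_eq0 x0. Qed.

Lemma euclid0 : euclid (0 : 'cV[R]_m) = 0.
Proof. by rewrite euclidE /nsq /dot mulmx0 mxE sqrtr0. Qed.

Lemma euclidZ c x : euclid (c *: x) = `|c| * euclid x.
Proof. by rewrite !euclidE nsqZ sqrtrM ?sqr_ge0 // sqrtr_sqr. Qed.

Lemma euclidN x : euclid (- x) = euclid x.
Proof. by rewrite -scaleN1r euclidZ normrN1 mul1r. Qed.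

Lemma cauchy_schwarz x y : dot x y <= euclid x * euclid y.
Proof.
have [->|y0] := eqVneq y 0.
  by rewrite euclid0 mulr0 /dot mulmx0 mxE.
have [->|x0] := eqVneq x 0.
  by rewrite euclid0 mul0r dotC /dot mulmx0 mxE.
have ux := euclid_gt0 x0; have uy := euclid_gt0 y0.
have := nsq_ge0 (euclid y *: x - euclid x *: y).
rewrite -scaleN1r scalerA nsqD !nsqZ dotZl dotZr -!sqr_euclid.
set u := euclid x in ux *; set v := euclid y in uy *.
move=> h; have {h} : 0 <= 2 * (u * v) * (u * v - dot x y) by nra.
by rewrite pmulr_rge0 ?subr_ge0 // !mulr_gt0.
Qed.

Lemma euclidD x y : euclid (x + y) <= euclid x + euclid y.
Proof.
have h0 := euclid_ge0 x; have h1 := euclid_ge0 y; have h2 := euclid_ge0 (x + y).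
rewrite -(ler_pXn2r (isT : (0 < 2)%N)) ?nnegrE ?addr_ge0 //.
rewrite sqr_euclid nsqD sqrrD !sqr_euclid.
have := cauchy_schwarz x y; lra.
Qed.

End Dot.

Lemma le_euclid m q (x : 'cV[R]_m) (y : 'cV[R]_q) c :
  0 <= c -> nsq x <= c ^+ 2 * nsq y -> euclid x <= c * euclid y.
Proof.
move=> c0; rewrite -!sqr_euclid -exprMn ler_pXn2r ?nnegrE ?mulr_ge0 ?euclid_ge0 //.
Qed.

Lemma dot_mulmxl m q (A : 'M[R]_(m, q)) x y : dot (A *m x) y = dot x (A^T *m y).
Proof. by rewrite /dot trmx_mul mulmxA. Qed.

Lemma nsq_isometry m q (V : 'M[R]_(m, q)) x : V^T *m V = 1%:M -> nsq (V *m x) = nsq x.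
Proof. by move=> h; rewrite /nsq dot_mulmxl mulmxA h mul1mx. Qed.

Lemma euclid_isometry m q (V : 'M[R]_(m, q)) x :
  V^T *m V = 1%:M -> euclid (V *m x) = euclid x.
Proof. by move=> h; rewrite !euclidE nsq_isometry. Qed.

Section OpNorm.
Variables m q : nat.
Implicit Types X Y : 'M[R]_(m, q).

Lemma opnorm_leD X Y s t : opnorm_le X s -> opnorm_le Y t -> opnorm_le (X + Y) (s + t).
Proof.
move=> hX hY x; rewrite mulmxDl mulrDl.
exact: le_trans (euclidD _ _) (lerD (hX x) (hY x)).
Qed.

Lemma opnorm_leN X t : opnorm_le X t -> opnorm_le (- X) t.
Proof. by move=> h x; rewrite mulNmx euclidN. Qed.

Lemma opnorm_leZ c X t : opnorm_le X t -> opnorm_le (c *: X) (`|c| * t).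
Proof. by move=> h x; rewrite -scalemxAl euclidZ -mulrA ler_wpM2l. Qed.

Lemma opnorm_leW X s t : s <= t -> opnorm_le X s -> opnorm_le X t.
Proof. by move=> st h x; apply: le_trans (h x) _; rewrite ler_wpM2r ?euclid_ge0. Qed.

Lemma opnorm_leM l X (Y : 'M[R]_(q, l)) s t :
  0 <= s -> opnorm_le X s -> opnorm_le Y t -> opnorm_le (X *m Y) (s * t).
Proof.
by move=> s0 hX hY x; rewrite -mulmxA (le_trans (hX _)) // -mulrA ler_wpM2l.
Qed.

Lemma opnorm_le_frob X t : 0 <= t -> \sum_i \sum_j X i j ^+ 2 <= t ^+ 2 -> opnorm_le X t.
Proof.
move=> t0 h x; apply: le_euclid => //.
apply: le_trans (_ : (\sum_i \sum_j X i j ^+ 2) * nsq x <= _); last first.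
  by rewrite ler_wpM2r ?nsq_ge0.
rewrite nsqE mulr_suml; apply: ler_sum => i _.
pose r : 'cV[R]_q := \col_j X i j.
have -> : (X *m x) i 0 = dot r x.
  by rewrite mxE dotE; apply: eq_bigr => j _; rewrite mxE.
have -> : \sum_j X i j ^+ 2 = nsq r.
  by rewrite nsqE; apply: eq_bigr => j _; rewrite mxE.
have := cauchy_schwarz r x; have := cauchy_schwarz (- r) x.
rewrite euclidN -scaleN1r dotZl mulN1r -!sqr_euclid -exprMn => h1 h2.
rewrite -[leLHS]real_normK ?num_real // ler_pXn2r ?nnegrE ?mulr_ge0 ?euclid_ge0 //.
by rewrite ler_norml h2 andbT lerNl.
Qed.

End OpNorm.

Lemma opnorm_le_diag m (s : 'rV[R]_m) t :
  (forall i, `|s 0 i| <= t) -> opnorm_le (diag_mx s) t.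
Proof.
move=> h x.
(* A negative [t] can bound absolute values only when there is no index at all. *)
have [t0|t0] := leP 0 t; last first.
  suff -> : x = 0 by rewrite mulmx0 !euclid0 mulr0.
  by apply/colP => i; have := le_lt_trans (h i) t0; rewrite normr_lt0.
apply: le_euclid => //; rewrite !nsqE mulr_sumr; apply: ler_sum => i _.
rewrite mul_diag_mx mxE exprMn ler_wpM2r ?sqr_ge0 //.
by rewrite -[leLHS]real_normK ?num_real // ler_pXn2r ?nnegrE.
Qed.

(** * Spectral theorem for real symmetric matrices *)

Section RealSpectral.

(** Over the complex numbers the matrix is Hermitian, hence diagonalizable with real spectrum. A
    real root of its characteristic polynomial is also a root of that of [A], so no eigenvector has
    to be made real by hand. *)
Lemma symmetric_eigenvalue n (A : 'M[R]_n.+1) : A^T = A -> exists a, eigenvalue A a.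
Proof.
move=> Asym; pose C := (R[i])%C; pose phi := @real_complex R.
pose AC : 'M[C]_n.+1 := map_mx phi A.
have ACsym : AC \is symmetricmx.
  by apply/is_hermitianmxP; rewrite expr0 scale1r /AC map_mx_id // map_trmx Asym.
have ACreal : AC \is a realmx.
  apply/mxOverP => i j; rewrite mxE.
  by apply/complex_realP; exists (A i j).
have Aherm := realsym_hermsym ACsym ACreal.
have /hermitian_normalmx /orthomx_spectralP A_eq := Aherm.
have /mxOverP/(_ 0 0) := hermitian_spectral_diag_real Aherm.
set a := spectral_diag AC 0 0 => ar.
have : eigenvalue AC a.
  apply/eigenvalueP; exists (row 0 (spectralmx AC)).
    rewrite -row_mul {2}A_eq !mulmxA mulmxV ?spectral_unit // mul1mx.
    by apply/rowP => j; rewrite mxE mul_diag_mx !mxE.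
  apply/eqP => h0; have := mulmxV (spectral_unit AC).
  move/(congr1 (row 0)); rewrite row_mul h0 mul0mx => /rowP/(_ 0).
  by rewrite !mxE eqxx => /eqP; rewrite eq_sym oner_eq0.
rewrite eigenvalue_root_char /AC -map_char_poly.
have -> : a = phi (complex.Re a).
  by rewrite /phi RRe_real.
rewrite fmorph_root => h; exists (complex.Re a); by rewrite eigenvalue_root_char.
Qed.

(** The reflection in the hyperplane orthogonal to [v - e0] exchanges the unit vectors [e0] and [v].
    Being a symmetric involution, it conjugates a symmetric matrix to a symmetric one. *)
Lemma householder n (v : 'cV[R]_n.+1) : nsq v = 1 ->
  exists Q : 'M[R]_n.+1, [/\ Q^T = Q, Q *m Q = 1%:M & Q *m delta_mx 0 0 = v].
Proof.
move=> v1; pose e0 : 'cV[R]_n.+1 := delta_mx 0 0.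
have de x : dot x e0 = x 0 0 by rewrite /dot -colE !mxE.
have ne : nsq e0 = 1 by rewrite /nsq de mxE !eqxx.
have [->|w0] := eqVneq v e0; first by exists 1%:M; rewrite trmx1 !mul1mx.
pose w := v - e0; have nw0 : nsq w != 0 by rewrite nsq_eq0 subr_eq0.
have nw : nsq w = 2 - 2 * v 0 0.
  by rewrite /w nsqD -scaleN1r dotZr nsqZ v1 ne de; ring.
have ww : w^T *m w = (nsq w)%:M by rewrite [LHS]mx11_scalar.
exists (1%:M - (2 / nsq w) *: (w *m w^T)); split.
- by rewrite linearB linearZ /= trmx1 trmx_mul trmxK.
- rewrite mulmxBl mul1mx mulmxBr mulmx1 -!scalemxAl -!scalemxAr.
  rewrite -mulmxA (mulmxA w^T) ww mul_scalar_mx -scalemxAr !scalerA.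
  rewrite (_ : 2 / nsq w * (_ * _) = 2 / nsq w + 2 / nsq w); last by field.
  by rewrite scalerDl opprB addrK subrK.
- rewrite mulmxBl mul1mx -scalemxAl -mulmxA.
  have -> : w^T *m delta_mx 0 0 = (dot w e0)%:M by rewrite [LHS]mx11_scalar.
  rewrite mul_mx_scalar scalerA de !mxE !eqxx /=.
  have -> : 2 / nsq w * (v 0 0 - 1%:R) = -1.
    by rewrite nw; move: nw0; rewrite nw => h; field.
  by rewrite scaleN1r opprK addrC subrK.
Qed.

(** Deflation: conjugating by the reflection that sends [e0] to a unit eigenvector makes the first
    column a multiple of [e0]. By symmetry the matrix becomes block diagonal, and the induction
    hypothesis diagonalizes the lower block. *)
Lemma real_spectral n (A : 'M[R]_n) : A^T = A ->
  exists (P : 'M[R]_n) (l : 'rV[R]_n), P^T *m P = 1%:M /\ A = P *m diag_mx l *m P^T.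
Proof.
elim: n A => [|n IH] A Asym.
  by exists 1%:M, 0; split; apply/matrixP => -[].
have [a /eigenvalueP[u uA u0]] := symmetric_eigenvalue Asym.
have ut0 : u^T != 0 by rewrite trmx_eq0.
pose v := (euclid u^T)^-1 *: u^T.
have v1 : nsq v = 1.
  by rewrite nsqZ -sqr_euclid exprVn mulVf // expf_neq0 // gt_eqF // euclid_gt0.
have Av : A *m v = a *: v.
  by rewrite -scalemxAr -{1}Asym -trmx_mul uA linearZ /= !scalerA mulrC.
have [Q [Qt QQ Qe]] := householder v1.
pose B : 'M[R]_(1 + n) := Q *m A *m Q.
have Bt : B^T = B by rewrite !trmx_mul Qt Asym mulmxA.
have Be : B *m delta_mx 0 0 = a *: (delta_mx 0 0 : 'cV[R]_n.+1).
  by rewrite -!mulmxA Qe Av -scalemxAr -Qe mulmxA QQ mul1mx.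
have Bcol i : B i 0 = a * (i == 0)%:R.
  by move/colP/(_ i): Be; rewrite -colE !mxE andbT.
have l0 : lshift n 0 = 0 :> 'I_(1 + n) by apply: val_inj.
have ul : ulsubmx B = a%:M.
  by apply/matrixP => i j; rewrite !ord1 2![in LHS]mxE l0 Bcol !mxE !eqxx mulr1.
have dl : dlsubmx B = 0.
  by apply/matrixP => i j; rewrite ord1 2![in LHS]mxE l0 Bcol mxE mulr0.
have ur : ursubmx B = 0 by rewrite -Bt -trmx_dlsub dl trmx0.
have [|P' [l' [P'1 dr]]] := IH (drsubmx B); first by rewrite trmx_drsub Bt.
pose T : 'M[R]_(1 + n) := block_mx 1%:M 0 0 P'.
have TT : T^T *m T = 1%:M.
  rewrite /T tr_block_mx mulmx_block !trmx0 trmx1.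
  by rewrite !(mulmx0, mul0mx, addr0, add0r, mulmx1) P'1 -scalar_mx_block.
pose l : 'rV[R]_(1 + n) := row_mx a%:M l'.
have TB : T *m diag_mx l *m T^T = B.
  rewrite /l diag_mx_row /T tr_block_mx !mulmx_block.
  rewrite !trmx0 trmx1 !(mulmx0, mul0mx, addr0, add0r, mulmx1, mul1mx) -dr.
  rewrite -[RHS]submxK ul dl ur; congr block_mx.
  by apply/matrixP => i j; rewrite !mxE !ord1 eqxx.
exists (Q *m T), l; split.
  by rewrite trmx_mul Qt -mulmxA (mulmxA Q) QQ mul1mx.
have -> : Q *m T *m diag_mx l *m (Q *m T)^T = Q *m (T *m diag_mx l *m T^T) *m Q.
  by rewrite trmx_mul Qt !mulmxA.
by rewrite TB /B !mulmxA QQ mul1mx -mulmxA QQ mulmx1.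
Qed.

End RealSpectral.

(** * Davis-Kahan *)

Lemma wide_kernel m (A : 'M[R]_(m, m.+1)) : exists2 w : 'cV[R]_m.+1, w != 0 & A *m w = 0.
Proof.
have : kermx A^T != 0.
  rewrite -mxrank_eq0 mxrank_ker -lt0n subn_gt0 ltnS.
  exact: rank_leq_col.
case/rowV0Pn => v /sub_kermxP vA v0; exists v^T; first by rewrite trmx_eq0.
by apply: trmx_inj; rewrite trmx_mul trmxK vA trmx0.
Qed.

Lemma dot_spectral N (U : 'M[R]_N) (lam : 'rV[R]_N) w : U^T *m U = 1%:M ->
  dot (U *m w) (U *m diag_mx lam *m U^T *m (U *m w)) = \sum_i lam 0 i * w i 0 ^+ 2.
Proof.
move=> UU; rewrite dot_mulmxl !mulmxA UU mul1mx -(mulmxA (diag_mx lam)) UU mulmx1.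
rewrite dotE; apply: eq_bigr => i _; rewrite mul_diag_mx mxE; ring.
Qed.

Lemma dot_opnorm N (E : 'M[R]_N) e z : opnorm_le E e -> dot z (E *m z) <= e * nsq z.
Proof.
move=> hE; apply: le_trans (cauchy_schwarz _ _) _.
rewrite -sqr_euclid expr2 mulrCA ler_wpM2l ?euclid_ge0 //.
Qed.

(* Courant-Fischer: among the first m.+1 eigenvectors of M some combination is
   orthogonal to the m columns of V0, where L0 is at least b. *)
Lemma weyl_lower N m (M L0 : 'M[R]_N) (V0 : 'M[R]_(N, m)) (U : 'M[R]_N)
    (lam : 'rV[R]_N) (b e : R) :
  U^T *m U = 1%:M -> M = U *m diag_mx lam *m U^T ->
  (forall i j : 'I_N, (i <= j)%N -> lam 0 i <= lam 0 j) ->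
  (forall z, V0^T *m z = 0 -> b * nsq z <= dot z (L0 *m z)) ->
  opnorm_le (M - L0) e ->
  forall i : 'I_N, (m <= i)%N -> b - e <= lam 0 i.
Proof.
move=> UU MU mono hb hE i mi.
have lemN : (m.+1 <= N)%N := leq_ltn_trans mi (ltn_ord i).
pose J : 'M[R]_(N, m.+1) := pid_mx m.+1.
have JJ : J^T *m J = 1%:M by rewrite tr_pid_mx mul_pid_mx minnn (minn_idPr lemN) pid_mx_1.
have [w w0 Aw] := wide_kernel (V0^T *m U *m J).
pose z := U *m (J *m w).
have nz : nsq z = nsq w by rewrite !nsq_isometry.
have n0 : 0 < nsq w by rewrite lt_neqAle nsq_ge0 eq_sym nsq_eq0 w0.
have h1 : b * nsq w <= dot z (L0 *m z) by rewrite -nz hb // !mulmxA.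
have h2 : - e * nsq w <= dot z ((M - L0) *m z).
  have := dot_opnorm z (opnorm_leN hE).
  by rewrite nz mulNmx -scaleN1r dotZr; lra.
have h3 : dot z (M *m z) <= lam 0 i * nsq w.
  rewrite MU dot_spectral // -(nsq_isometry w JJ) nsqE mulr_sumr.
  apply: ler_sum => j _; have [jm|mj] := leqP j m.
    by rewrite ler_wpM2r ?sqr_ge0 // mono // (leq_trans jm).
  suff -> : (J *m w) j 0 = 0 by rewrite expr0n /= !mulr0.
  by rewrite mxE big1 // => l _; rewrite mxE [(j < m.+1)%N]ltnNge mj andbF mul0r.
move: h2; rewrite mulmxBl dotBr => h2.
have : (b - e) * nsq w <= lam 0 i * nsq w by lra.
by rewrite ler_pM2r.
Qed.

(* At a top right singular vector x0 of X, with t = |X x0|, the Sylvester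
   equation gives (be - c) t <= |F x0| + (a - c) t once c is so small that
   |lam0 - c| <= a - c. *)
Lemma sylvester_bound N m (X F : 'M[R]_(N, m)) (lam : 'rV[R]_N) (lam0 mu : 'rV[R]_m)
    (P : 'M[R]_m) (a be e : R) :
  diag_mx lam *m X = X *m diag_mx lam0 + F ->
  (forall i (x : 'cV[R]_m), (X *m x) i 0 != 0 -> be <= lam 0 i) ->
  (forall i, lam0 0 i <= a) -> a < be -> opnorm_le F e ->
  P^T *m P = 1%:M -> X^T *m X = P *m diag_mx mu *m P^T ->
  forall i, Num.sqrt (mu 0 i) * (be - a) <= e.
Proof.
move=> sylv hbe ha abe hF PP XX i.
have nX y : nsq (X *m (P *m y)) = \sum_i mu 0 i * y i 0 ^+ 2.
  by rewrite /nsq dot_mulmxl (mulmxA X^T) XX dot_spectral.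
have [i0 hi0] : exists i0, forall j, mu 0 j <= mu 0 i0.
  by have [i0 _ h] := @arg_maxP _ _ _ i xpredT (fun i => mu 0 i) isT; exists i0 => j; apply: h.
have nXle x : nsq (X *m x) <= mu 0 i0 * nsq x.
  have PPt : P *m P^T = 1%:M by apply: mulmx1C.
  have -> : x = P *m (P^T *m x) by rewrite mulmxA PPt mul1mx.
  rewrite nX nsq_isometry // nsqE mulr_sumr; apply: ler_sum => j _.
  by rewrite ler_wpM2r ?sqr_ge0 // hi0.
pose y0 : 'cV[R]_m := delta_mx i0 0.
pose x0 := P *m y0.
have n0 : nsq x0 = 1.
  by rewrite nsq_isometry // /nsq /dot -colE !mxE !eqxx.
have nX0 : nsq (X *m x0) = mu 0 i0.
  rewrite nX (bigD1 i0) //= big1 ?addr0 => [|j ji]; rewrite mxE ?eqxx ?mulr1 ?expr1n ?mulr1 //.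
  by rewrite (negbTE ji) expr0n /= mulr0.
have mu0 : 0 <= mu 0 i0 by rewrite -nX0 nsq_ge0.
set t : R := Num.sqrt (mu 0 i0).
have t0 : 0 <= t by exact: sqrtr_ge0.
have it : Num.sqrt (mu 0 i) <= t by rewrite ler_sqrt // hi0.
apply: le_trans (_ : t * (be - a) <= e).
  by rewrite ler_wpM2r // subr_ge0 ltW.
have e1 : euclid x0 = 1 by rewrite euclidE n0 sqrtr1.
have eX0 : euclid (X *m x0) = t by rewrite euclidE nX0.
pose B : R := \sum_j (a - lam0 0 j).
have B0 : 0 <= B by apply: sumr_ge0 => j _; rewrite subr_ge0.
have Bj j : a - lam0 0 j <= B.
  by rewrite /B (bigD1 j) //= lerDl sumr_ge0 // => l _; rewrite subr_ge0.
pose c : R := a - B.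
have h1 : euclid (X *m ((diag_mx lam0 - c%:M) *m x0)) <= t * B.
  apply: le_trans (_ : t * euclid ((diag_mx lam0 - c%:M) *m x0) <= _).
    by apply: le_euclid => //; rewrite sqr_sqrtr.
  rewrite ler_wpM2l // -[leRHS]mulr1 -e1.
  have -> : diag_mx lam0 - c%:M = diag_mx (lam0 - const_mx c).
    by rewrite -diag_const_mx linearB.
  apply: opnorm_le_diag => j; rewrite !mxE ler_norml /c; apply/andP; split.
    by have := Bj j; lra.
  by have := ha j; lra.
(* Only rows where [X x0] is nonzero count, and exactly there [lam] is known to be at least [be]. *)
have h2 : (be - c) * t <= euclid ((diag_mx lam - c%:M) *m (X *m x0)).
  rewrite -eX0 -ler_pdivlMl; last by rewrite /c; lra.
  have bec : 0 < be - c by rewrite /c; lra.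
  apply: le_euclid; first by rewrite invr_ge0 ltW.
  rewrite !nsqE mulr_sumr; apply: ler_sum => j _.
  have -> : diag_mx lam - c%:M = diag_mx (lam - const_mx c).
    by rewrite -diag_const_mx linearB.
  move: (X *m x0) (hbe j x0) => y hy.
  rewrite mul_diag_mx !mxE exprMn mulrA -exprMn.
  have [->|nz] := eqVneq (y j 0) 0; first by rewrite expr0n /= mulr0.
  rewrite ler_peMl ?sqr_ge0 // exprn_ege1 // ler_pdivlMl // mulr1.
  by rewrite lerD2r hy.
have h3 : (diag_mx lam - c%:M) *m (X *m x0) =
          X *m ((diag_mx lam0 - c%:M) *m x0) + F *m x0.
  rewrite !mulmxBl !mul_scalar_mx mulmxBr (mulmxA (diag_mx lam)) sylv mulmxDl -scalemxAr !mulmxA.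
  by rewrite addrAC.
have := euclidD (X *m ((diag_mx lam0 - c%:M) *m x0)) (F *m x0).
rewrite -h3; have := hF x0; rewrite e1 /c in h1 h2 *; lra.
Qed.

Lemma opnorm_le_isometry m q (V : 'M[R]_(m, q)) : V^T *m V = 1%:M -> opnorm_le V 1.
Proof. by move=> h x; rewrite euclid_isometry // mul1r. Qed.

Lemma orthogonal_mxC m (O : 'M[R]_m) : O^T *m O = 1%:M -> O *m O^T = 1%:M.
Proof. exact: mulmx1C. Qed.

Lemma opnorm_le_conj m (P : 'M[R]_m) (s : 'rV[R]_m) (t : R) : P^T *m P = 1%:M ->
  0 <= t -> (forall i, `|s 0 i| <= t) -> opnorm_le (P *m diag_mx s *m P^T) t.
Proof.
move=> PP t0 h; rewrite -[t]mulr1; apply: opnorm_leM => //; last first.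
  by apply: opnorm_le_isometry; rewrite trmxK; apply: mulmx1C.
rewrite -[t]mul1r; apply: opnorm_leM => //; first exact: opnorm_le_isometry.
exact: opnorm_le_diag.
Qed.

Lemma conj_diagM m (P : 'M[R]_m) (s t : 'rV[R]_m) : P^T *m P = 1%:M ->
  (P *m diag_mx s *m P^T) *m (P *m diag_mx t *m P^T) =
  P *m diag_mx (\row_i (s 0 i * t 0 i)) *m P^T.
Proof.
move=> PP; rewrite !mulmxA -(mulmxA (P *m diag_mx s)) PP mulmx1.
by rewrite -(mulmxA P) mulmx_diag.
Qed.

Lemma conj_diag1 m (P : 'M[R]_m) (s : 'rV[R]_m) : P^T *m P = 1%:M ->
  (forall i, s 0 i = 1) -> P *m diag_mx s *m P^T = 1%:M.
Proof.
move=> PP h; have -> : s = const_mx 1 by apply/rowP => i; rewrite mxE h.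
by rewrite diag_const_mx mulmx1 orthogonal_mxC.
Qed.

(** The sine matrix [X] has norm at most [s] by the Sylvester bound. The cosine matrix [Y = V0^T V]
    satisfies [Y Y^T = 1 - X^T X = H^2], so [O = H^-1 Y] is its orthogonal polar factor. The
    difference [V - V0 O] then splits into a term with [1 - H] and a term with [X], each of norm at
    most [s]. *)
Theorem davis_kahan N m (M L0 : 'M[R]_N) (V0 V : 'M[R]_(N, m)) (lam0 : 'rV[R]_m)
    (a b e s : R) : (m <= N)%N ->
  V0^T *m V0 = 1%:M -> L0 *m V0 = V0 *m diag_mx lam0 ->
  (forall i, lam0 0 i <= a) ->
  (forall z, V0^T *m z = 0 -> b * nsq z <= dot z (L0 *m z)) ->
  0 <= e -> opnorm_le (M - L0) e -> a < b - e -> 0 <= s -> s < 1 -> e <= s * (b - e - a) ->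
  bottom_eigvecs M V ->
  exists O : 'M[R]_m, orthogonal_mx O /\ opnorm_le (V - V0 *m O) (2 * s).
Proof.
move=> mN V0V0 L0V0 ha hb e0 hE abe s0 s1 es [VV [U [lam [UU [MU [mono VU]]]]]].
have hbe := weyl_lower UU MU mono hb hE.
pose J : 'M[R]_(N, m) := pid_mx m.
have VUJ : V = U *m J.
  apply/matrixP => i j; rewrite (VU i j (widen_ord mN j)) // mxE.
  rewrite (bigD1 (widen_ord mN j)) //= big1 ?addr0.
    by rewrite mxE /= eqxx ltn_ord mulr1.
  move=> l; rewrite -val_eqE /= => lj; rewrite mxE (negbTE lj) mulr0 //.
pose K : 'M[R]_N := diag_mx (\row_i (m <= i)%N%:R).
have JK : J *m J^T + K = 1%:M.
  rewrite tr_pid_mx mul_pid_mx minnn (minn_idPl (leqnn _)).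
  apply/matrixP => i j; rewrite !mxE; have [->|ij] := eqVneq i j.
    by rewrite eqxx /= mulr1n ltnNge; case: (m <= j)%N; rewrite ?add0r ?addr0.
  by rewrite (negbTE (ij : val i != val j)) /= mulr0n addr0.
have KK : K *m K = K.
  by rewrite mulmx_diag; congr diag_mx; apply/rowP => i; rewrite !mxE -natrM mulnb andbb.
have Kt : K^T = K by rewrite tr_diag_mx.
(* Coordinates of [V0] along the eigenvectors of [M] of index at least [m]. *)
pose X := K *m U^T *m V0.
have sylv : diag_mx lam *m X = X *m diag_mx lam0 + K *m U^T *m (M - L0) *m V0.
  rewrite mulmxBr mulmxBl -(mulmxA _ L0) L0V0 [RHS]addrC !mulmxA subrK.
  rewrite MU !mulmxA -(mulmxA K U^T U) UU mulmx1.
  by rewrite diag_mxC.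
have hX i (x : 'cV_m) : (X *m x) i 0 != 0 -> b - e <= lam 0 i.
  move=> h; apply: hbe; move: h; rewrite /X -!mulmxA mul_diag_mx !mxE.
  by case: (m <= i)%N => //; rewrite mul0r eqxx.
have hF : opnorm_le (K *m U^T *m (M - L0) *m V0) e.
  have hK : opnorm_le K 1.
    by apply: opnorm_le_diag => i; rewrite mxE; case: (m <= i)%N; rewrite ?normr1 ?normr0.
  have hU : opnorm_le U^T 1 by apply: opnorm_le_isometry; rewrite trmxK orthogonal_mxC.
  have := opnorm_leM ler01 hK hU; rewrite mulr1 => /(opnorm_leM ler01)/(_ hE).
  by rewrite mul1r => /(opnorm_leM e0)/(_ (opnorm_le_isometry V0V0)); rewrite mulr1.
have [P [mu [PP XX]]] : exists (P : 'M[R]_m) mu, P^T *m P = 1%:M /\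
    X^T *m X = P *m diag_mx mu *m P^T.
  by apply: real_spectral; rewrite trmx_mul trmxK.
have nX y : nsq (X *m (P *m y)) = \sum_i mu 0 i * y i 0 ^+ 2.
  by rewrite /nsq dot_mulmxl (mulmxA X^T) XX dot_spectral.
have mu0 i : 0 <= mu 0 i.
  have := nsq_ge0 (X *m (P *m delta_mx i 0)); rewrite nX (bigD1 i) //= big1 ?addr0.
    by rewrite mxE !eqxx expr1n mulr1.
  by move=> j ji; rewrite mxE (negbTE ji) expr0n /= mulr0.
have mus i : mu 0 i <= s ^+ 2.
  have := sylvester_bound sylv hX ha abe hF PP XX i => h.
  have : Num.sqrt (mu 0 i) <= s.
    have d0 : 0 < b - e - a by rewrite subr_gt0.
    by rewrite -(ler_pM2r d0); apply: le_trans h es.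
  by rewrite -(ler_pXn2r (isT : (0 < 2)%N)) ?nnegrE ?sqrtr_ge0 // sqr_sqrtr.
have s2 : s ^+ 2 <= s by rewrite expr2 ler_piMl // ltW.
have s21 : s ^+ 2 < 1 by apply: le_lt_trans s1.
have X_le : opnorm_le X s.
  move=> x; apply: le_euclid => //.
  have -> : x = P *m (P^T *m x) by rewrite mulmxA orthogonal_mxC // mul1mx.
  rewrite nX nsq_isometry // nsqE mulr_sumr; apply: ler_sum => j _.
  by rewrite ler_wpM2r ?sqr_ge0.
pose h : 'rV[R]_m := \row_i Num.sqrt (1 - mu 0 i).
have h0 i : 0 < h 0 i.
  by rewrite mxE sqrtr_gt0; have := mus i; lra.
pose H := P *m diag_mx h *m P^T.
pose Hi := P *m diag_mx (\row_i (h 0 i)^-1) *m P^T.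
have HHi : H *m Hi = 1%:M.
  by rewrite conj_diagM // conj_diag1 // => i; rewrite mxE [X in _ * X]mxE divff // gt_eqF.
pose Y := V0^T *m V.
have XXE : X^T *m X = 1%:M - Y *m Y^T.
  rewrite /X /Y VUJ !trmx_mul !trmxK Kt !mulmxA.
  rewrite -(mulmxA (V0^T *m U) K K) KK.
  have -> : K = 1%:M - J *m J^T by rewrite -JK addrC addKr.
  by rewrite mulmxBr !mulmxBl mulmx1 -(mulmxA V0^T U U^T) (orthogonal_mxC UU) mulmx1 V0V0 !mulmxA.
have YY : Y *m Y^T = H *m H.
  have -> : Y *m Y^T = 1%:M - X^T *m X by rewrite XXE opprB addrC subrK.
  rewrite XX conj_diagM // -[1%:M](@conj_diag1 _ P (const_mx 1)) // => [|i]; last by rewrite mxE.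
  rewrite -mulmxBl -mulmxBr; congr (_ *m _ *m _); rewrite -raddfB; congr diag_mx.
  apply/rowP => i; rewrite !mxE -expr2 sqr_sqrtr //; by have := mus i; lra.
have Ht : H^T = H by rewrite /H !trmx_mul trmxK tr_diag_mx mulmxA.
have Hit : Hi^T = Hi by rewrite /Hi !trmx_mul trmxK tr_diag_mx mulmxA.
have HiH : Hi *m H = 1%:M by apply: mulmx1C.
have hH : opnorm_le (1%:M - H) s.
  rewrite -[1%:M](@conj_diag1 _ P (const_mx 1)) // => [|i]; last by rewrite mxE.
  rewrite -mulmxBl -mulmxBr -raddfB; apply: opnorm_le_conj => // i.
  (* On [0, 1] a number is at most its square root, so [1 - sqrt (1 - mu)] is at most [mu], hence at
     most [s ^ 2] and [s]. *)
  rewrite !mxE ger0_norm.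
    have m1 := mus i; have m0 := mu0 i.
    suff : 1 - mu 0 i <= Num.sqrt (1 - mu 0 i) by lra.
    rewrite -[leLHS]sqr_sqrtr; last by lra.
    by rewrite expr2 ler_piMl ?sqrtr_ge0 // -[leRHS]sqrtr1 ler_sqrt // gerBl.
  by rewrite subr_ge0 -[leRHS]sqrtr1 ler_sqrt // gerBl.
clearbody H Hi.
pose O := Hi *m Y.
have OO' : O *m O^T = 1%:M.
  by rewrite /O trmx_mul Hit mulmxA -(mulmxA Hi) YY !mulmxA HiH mul1mx HHi.
have OO : O^T *m O = 1%:M by apply: mulmx1C.
have HO : H *m O = Y by rewrite /O mulmxA HHi mul1mx.
clearbody O; exists O; split => //.
have -> : V - V0 *m O = V *m O^T *m (1%:M - H) *m O - U *m X *m O.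
  rewrite mulmxBr mulmx1 mulmxBl -(mulmxA V) OO mulmx1.
  have -> : V *m O^T *m H *m O = V *m Y^T *m O.
    by rewrite -HO trmx_mul Ht !mulmxA.
  have -> : U *m X = V0 - V *m Y^T.
    rewrite /X /Y trmx_mul trmxK.
    have -> : K = 1%:M - J *m J^T by rewrite -JK addrC addKr.
    rewrite -mulmxA mulmxBl mul1mx mulmxBr !(mulmxA U) (orthogonal_mxC UU) mul1mx.
    by rewrite VUJ !trmx_mul !mulmxA.
  by rewrite mulmxBl opprB addrA subrK.
have o1 : opnorm_le O 1 by apply: opnorm_le_isometry.
have hUX : opnorm_le (U *m X *m O) s.
  have := opnorm_leM ler01 (opnorm_le_isometry UU) X_le.
  by rewrite mul1r => /(opnorm_leM s0)/(_ o1); rewrite mulr1.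
have hO : opnorm_le O^T 1 by apply: opnorm_le_isometry; rewrite trmxK.
have := opnorm_leM ler01 (opnorm_le_isometry VV) hO; rewrite mulr1.
move=> /(opnorm_leM ler01)/(_ hH); rewrite mul1r => /(opnorm_leM s0)/(_ o1).
rewrite mulr1 => hVO; have := opnorm_leD hVO (opnorm_leN hUX).
by rewrite mulrDl mul1r.
Qed.

(** * Spectral gap of the mean Laplacian *)

Section ClusterGap.
Variables (n k : nat) (cl : 'I_n -> 'I_k) (p eta : R).
Hypotheses (n2 : (2 <= n)%N) (k2 : (2 <= k)%N) (p0 : 0 < p) (eta_lt : eta < 1 / 2).
Hypothesis cl_surj : forall i : 'I_k, exists j, cl j = i.

Local Notation ns i := ((csize cl i)%:R : R).
Local Notation q := (p / dbar n p * (1 - 2 * eta)).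
Local Notation abar := (alphabar n p eta).
Local Notation C := (Cbar cl p eta).
Local Notation B := (Bbar cl p eta).
Local Notation Th := (Theta cl).

Definition nmin : nat := \big[minn/n]_(i < k) csize cl i.
Definition nmax : nat := \max_(i < k) csize cl i.
(** The excess of [alphabar] over 1 equals the diagonal entry of [Th B Th^T]. It cancels that
    diagonal, in accordance with the absence of self-loops in the model; see [LbarE]. *)
Definition Lbar : 'M[R]_n := abar%:M - Th *m B *m Th^T.

Lemma dbar_gt0 : 0 < dbar n p.
Proof. by rewrite mulr_gt0 // ltr0n; case: n n2 => [|[]]. Qed.

Lemma q_gt0 : 0 < q.
Proof. by apply: mulr_gt0; [rewrite divr_gt0 // dbar_gt0 | rewrite subr_gt0 mulrC -ltr_pdivlMr]. Qed.

Lemma csize_gt0 i : (0 < csize cl i)%N.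
Proof. by have [j <-] := cl_surj i; apply/card_gt0P; exists j; rewrite inE. Qed.

Lemma ns_gt0 i : 0 < ns i.
Proof. by rewrite ltr0n csize_gt0. Qed.

Lemma csizeE i : csize cl i = (\sum_(j < n) (cl j == i))%N.
Proof. by rewrite /csize -sum1_card big_mkcond; apply: eq_bigr => j _; rewrite inE; case: eqP. Qed.

Lemma sum_csize : (\sum_(i < k) csize cl i = n)%N.
Proof.
under eq_bigr do rewrite csizeE.
rewrite exchange_big /= -[RHS]card_ord -sum1_card; apply: eq_bigr => j _.
by rewrite (bigD1 (cl j)) //= eqxx big1 ?addn0 // => i /negbTE; rewrite eq_sym => ->.
Qed.

Lemma sum_ns : \sum_i ns i = n%:R.
Proof. by rewrite -natr_sum sum_csize. Qed.

Lemma nmin_le i : (nmin <= csize cl i)%N.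
Proof.
rewrite /nmin; have := mem_index_enum i; elim: (index_enum _) => [//|j s IH].
by rewrite big_cons inE geq_min => /predU1P[->|/IH ->]; rewrite ?leqnn ?orbT.
Qed.

Lemma nmax_ge i : (csize cl i <= nmax)%N.
Proof. exact: leq_bigmax. Qed.

Lemma csizeD_nmin i : (csize cl i + nmin <= n)%N.
Proof.
have [i' ii'] : exists i' : 'I_k, i' != i.
  case: k cl i k2 => [|[|k']] // f i _.
  by exists (if i == 0 then lift 0 0 else 0); case: ifP => [/eqP->|/negbT]; rewrite 1?eq_sym.
rewrite -[leqRHS]sum_csize (bigD1 i) //= (bigD1 i') //= leq_add2l.
by rewrite (leq_trans (nmin_le i')) // leq_addr.
Qed.

Lemma nmaxD_nmin : (nmax + nmin <= n)%N.
Proof.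
have : (nmax <= n - nmin)%N.
  by apply/bigmax_leqP => i _; have := csizeD_nmin i; lia.
have [j _] := cl_surj (Ordinal (leq_trans (isT : 0 < 2)%N k2)).
have := csizeD_nmin (cl j); lia.
Qed.

Lemma n_le_kmax : (n <= k * nmax)%N.
Proof.
rewrite -[leqLHS]sum_csize -[k in (k * _)%N]card_ord -sum_nat_const.
by apply: leq_sum => i _; apply: nmax_ge.
Qed.

Lemma Theta_isometry : Th^T *m Th = 1%:M.
Proof.
apply/matrixP => i i'; rewrite !mxE.
have [<-|ii'] := eqVneq i i'; last first.
  rewrite big1 // => j _; rewrite !mxE; case: eqP => [->|_]; last by rewrite mul0r.
  by rewrite (negbTE ii') mulr0.
under eq_bigr => j _.
  have -> : Th^T i j * Th j i = (ns i)^-1 * (cl j == i)%:R.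
    rewrite !mxE; case: eqP => _; rewrite ?mul0r ?mulr0 // mulr1.
    by rewrite -invfM -expr2 sqr_sqrtr // ler0n.
  over.
by rewrite -mulr_sumr -natr_sum -csizeE mulVf // gt_eqF // ns_gt0.
Qed.

Definition sqrt_sizes : 'cV[R]_k := \col_i Num.sqrt (ns i).

(** A diagonal matrix minus a rank one matrix. The rank one part vanishes on the hyperplane
    orthogonal to [sqrt_sizes], while [sqrt_sizes] itself is the test vector for the largest
    eigenvalue of [C]. *)
Lemma BbarE : B = q *: (2 *: diag_mx (\row_i ns i) - sqrt_sizes *m sqrt_sizes^T).
Proof.
apply/matrixP => i j; rewrite !mxE big_ord1 !mxE.
have [<-|ij] := eqVneq i j; rewrite ?mulr1n ?mulr0n.
  rewrite -expr2 sqr_sqrtr ?ler0n //; ring.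
rewrite sqrtrM ?ler0n //; ring.
Qed.

Lemma nsq_sqrt_sizes : nsq sqrt_sizes = n%:R.
Proof. by rewrite nsqE -sum_ns; apply: eq_bigr => i _; rewrite mxE sqr_sqrtr ?ler0n. Qed.

Lemma dot_Bbar z : dot z (B *m z) = q * (2 * (\sum_i ns i * z i 0 ^+ 2) - dot sqrt_sizes z ^+ 2).
Proof.
rewrite BbarE -scalemxAl dotZr mulmxBl dotBr -scalemxAl dotZr; congr (_ * (2 * _ - _)).
  by rewrite dotE; apply: eq_bigr => i _; rewrite mul_diag_mx !mxE; ring.
have -> : sqrt_sizes *m sqrt_sizes^T *m z = dot sqrt_sizes z *: sqrt_sizes.
  by rewrite -mulmxA [sqrt_sizes^T *m z]mx11_scalar mul_mx_scalar.
by rewrite dotZr (dotC z) expr2.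
Qed.

Lemma dot_Cbar z : dot z (C *m z) = abar * nsq z - dot z (B *m z).
Proof. by rewrite mulmxBl mul_scalar_mx dotBr dotZr. Qed.

Section Eig.
Variables (U : 'M[R]_k) (lam : 'rV[R]_k).
Hypotheses (UU : U^T *m U = 1%:M) (CU : C = U *m diag_mx lam *m U^T).
Hypothesis mono : forall i j : 'I_k, (i <= j)%N -> lam 0 i <= lam 0 j.

(** The plane spanned by eigenvectors [i] and [j] meets the hyperplane orthogonal to [sqrt_sizes] in
    a nonzero vector. There the quadratic form of [C] is at most the right-hand side, and on the
    plane it is at least [lam 0 i]. *)
Lemma Cbar_low (i j : 'I_k) : (i < j)%N -> lam 0 i <= abar - 2 * nmin%:R * q.
Proof.
move=> ij.
have ijn : i != j by rewrite -val_eqE /= ltn_eqF.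
pose x := dot sqrt_sizes (col i U); pose y := dot sqrt_sizes (col j U).
have [al [be [ab0 xy]]] : exists al be : R, 0 < al ^+ 2 + be ^+ 2 /\ al * x + be * y = 0.
  have [y0|y0] := eqVneq y 0.
    have [x0|x0] := eqVneq x 0; first by exists 1, 0; rewrite x0; split; lra.
    by exists 0, 1; rewrite y0; split; lra.
  exists y, (- x); split; last by ring.
  by rewrite sqrrN ltr_pwDl ?sqr_ge0 // lt_neqAle eq_sym sqrf_eq0 y0 sqr_ge0.
pose w : 'cV[R]_k := al *: delta_mx i 0 + be *: delta_mx j 0.
have wi : w i 0 = al by rewrite !mxE !eqxx (negbTE ijn) /= mulr1 mulr0 addr0.
have wj : w j 0 = be by rewrite !mxE !eqxx eq_sym (negbTE ijn) /= mulr1 mulr0 add0r.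
have wl l : l != i -> l != j -> w l 0 = 0.
  by move=> /negbTE li /negbTE lj; rewrite !mxE li lj !mulr0 addr0.
have sumw (F : 'I_k -> R) : \sum_l F l * w l 0 ^+ 2 = F i * al ^+ 2 + F j * be ^+ 2.
  rewrite (bigD1 i) //= (bigD1 j) /=; last by rewrite eq_sym.
  by rewrite wi wj big1 ?addr0 // => l /andP[li lj]; rewrite wl // expr0n mulr0.
have nz : nsq (U *m w) = al ^+ 2 + be ^+ 2.
  rewrite nsq_isometry // nsqE -[al ^+ 2]mul1r -[be ^+ 2]mul1r -(sumw (fun=> 1)).
  by apply: eq_bigr => l _; rewrite mul1r.
have dz : dot sqrt_sizes (U *m w) = 0.
  by rewrite mulmxDr -!scalemxAr -!colE dotDr !dotZr.
have := dot_spectral lam w UU; rewrite -CU sumw dot_Cbar dot_Bbar dz nz expr0n subr0.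
set S := \sum_i _ => h.
have hS : nmin%:R * (al ^+ 2 + be ^+ 2) <= S.
  rewrite -nz nsqE mulr_sumr; apply: ler_sum => l _.
  by rewrite ler_wpM2r ?sqr_ge0 // ler_nat nmin_le.
have hl := mono (ltnW ij).
have hl2 : lam 0 i * be ^+ 2 <= lam 0 j * be ^+ 2 by rewrite ler_wpM2r ?sqr_ge0.
have hq : q * (nmin%:R * (al ^+ 2 + be ^+ 2)) <= q * S by rewrite ler_wpM2l // ltW // q_gt0.
rewrite -(ler_pM2r ab0); lra.
Qed.

(** Rayleigh quotient at [sqrt_sizes], whose squared norm is [n]; the sum of the squared sizes is at
    most [nmax * n]. *)
Lemma Cbar_last (i : 'I_k) : i = k.-1 :> nat -> abar - (2 * nmax%:R - n%:R) * q <= lam 0 i.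
Proof.
move=> ik.
have n0 : 0 < n%:R :> R by rewrite ltr0n ltnW.
pose w := U^T *m sqrt_sizes.
have su_w : sqrt_sizes = U *m w by rewrite mulmxA orthogonal_mxC // mul1mx.
have nw : nsq w = n%:R by rewrite -nsq_sqrt_sizes su_w nsq_isometry.
have := dot_spectral lam w UU; rewrite -CU -su_w dot_Cbar dot_Bbar -/(nsq sqrt_sizes) nsq_sqrt_sizes.
set S := \sum_i _ => h.
have hS : S <= nmax%:R * n%:R.
  rewrite -nsq_sqrt_sizes nsqE mulr_sumr; apply: ler_sum => l _.
  by rewrite ler_wpM2r ?sqr_ge0 // ler_nat nmax_ge.
have : \sum_j lam 0 j * w j 0 ^+ 2 <= lam 0 i * n%:R.
  rewrite -nw nsqE mulr_sumr; apply: ler_sum => l _.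
  by rewrite ler_wpM2r ?sqr_ge0 // mono // ik; have := ltn_ord l; lia.
rewrite -h => {}h.
have hq : q * S <= q * (nmax%:R * n%:R) by rewrite ler_wpM2l // ltW // q_gt0.
rewrite -(ler_pM2r n0); lra.
Qed.

End Eig.

Lemma LbarE i j : Lbar i j = (i == j)%:R -
  (if i == j then 0 else if cl i == cl j then p * (1 - 2 * eta) else - (p * (1 - 2 * eta)))
    / dbar n p.
Proof.
have s0 u : Num.sqrt (ns u) != 0 by rewrite gt_eqF // sqrtr_gt0 ns_gt0.
have -> : Lbar i j = abar *+ (i == j) -
    (Num.sqrt (ns (cl i)))^-1 * B (cl i) (cl j) * (Num.sqrt (ns (cl j)))^-1.
  rewrite /Lbar mxE [X in X + _ = _]mxE [X in _ + X = _]mxE; congr (_ - _); rewrite mxE.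
  rewrite (bigD1 (cl j)) //= [X in _ + X]big1 ?addr0 => [|l jl]; last first.
    by rewrite [Th^T _ _]mxE [Th _ _]mxE eq_sym (negbTE jl) mulr0.
  rewrite [Th^T _ _]mxE [Th _ _]mxE eqxx; congr (_ * _).
  rewrite mxE (bigD1 (cl i)) //= [X in _ + X]big1 ?addr0 => [|l jl]; last first.
    by rewrite [Th _ _]mxE eq_sym (negbTE jl) mul0r.
  by rewrite [Th _ _]mxE eqxx.
rewrite mxE; have [<-|ij] := eqVneq i j.
  rewrite eqxx mulr1n mul0r subr0 /alphabar.
  have -> : (Num.sqrt (ns (cl i)))^-1 * (ns (cl i) * p / dbar n p * (1 - 2 * eta)) *
      (Num.sqrt (ns (cl i)))^-1 = p / dbar n p * (1 - 2 * eta).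
    rewrite -[ns (cl i) in X in _ * X * _]sqr_sqrtr ?ler0n //.
    by field; rewrite s0 gt_eqF ?dbar_gt0.
  by rewrite addrK.
rewrite mulr0n !sub0r; case: eqP => [e|_].
  rewrite -e -[ns (cl i) in X in _ * X * _]sqr_sqrtr ?ler0n //.
  by field; rewrite s0 gt_eqF ?dbar_gt0.
rewrite sqrtrM ?ler0n //.
by field; rewrite !s0 gt_eqF ?dbar_gt0.
Qed.

Lemma leq_clusters : (k <= n)%N.
Proof.
rewrite -[leqRHS]sum_csize -[leqLHS]card_ord -sum1_card.
by apply: leq_sum => i _; apply: csize_gt0.
Qed.

(** Orthogonally to [Th Rk], the eigenvalues of [Lbar] are the last one of [C] and, off the range of
    [Th], [abar]. Balanced clusters keep both away from the first [k - 1] eigenvalues. *)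
Lemma cluster_davis_kahan (Rk : 'M[R]_(k, k.-1)) (M : 'M[R]_n) (V : 'M[R]_(n, k.-1)) (e s : R) :
  bottom_eigvecs C Rk -> (nmax <= 2 * nmin)%N ->
  0 <= e -> e < (1 - 2 * eta) / (2 * k%:R) -> opnorm_le (M - Lbar) e ->
  0 <= s -> s < 1 -> e <= s * ((1 - 2 * eta) / (2 * k%:R) - e) ->
  bottom_eigvecs M V ->
  exists O : 'M[R]_(k.-1), orthogonal_mx O /\ opnorm_le (V - Th *m Rk *m O) (2 * s).
Proof.
move=> [RR [U [lam [UU [CU [mono RU]]]]]] nmm e0 eg hE s0 s1 es hV.
have k0 : (0 < k)%N by apply: ltnW.
have k1 : (k.-1 < k)%N by rewrite prednK.
pose last := Ordinal k1.
pose J : 'M[R]_(k, k.-1) := pid_mx k.-1.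
have RUJ : Rk = U *m J.
  apply/matrixP => i j; rewrite (RU i j (widen_ord (ltnW k1) j)) // mxE.
  rewrite (bigD1 (widen_ord (ltnW k1) j)) //= big1 ?addr0.
    by rewrite mxE /= eqxx ltn_ord mulr1.
  by move=> l; rewrite -val_eqE /= => lj; rewrite mxE (negbTE lj) mulr0.
pose lam0 : 'rV[R]_(k.-1) := \row_i lam 0 (widen_ord (ltnW k1) i).
have CR : C *m Rk = Rk *m diag_mx lam0.
  rewrite RUJ CU -!mulmxA (mulmxA U^T) UU mul1mx; congr (_ *m _).
  apply/matrixP => i j; rewrite mul_diag_mx mul_mx_diag !mxE.
  case: eqP => [ij|_]; last by rewrite mulr0 mul0r.
  by rewrite mulrC; congr (_ * lam _ _); apply: val_inj.
have TT := Theta_isometry.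
pose V0 := Th *m Rk.
have V0V0 : V0^T *m V0 = 1%:M.
  by rewrite trmx_mul mulmxA -(mulmxA Rk^T) TT mulmx1.
have L0V0 : Lbar *m V0 = V0 *m diag_mx lam0.
  rewrite /V0 -(mulmxA Th) -CR /Lbar mulmxBl mul_scalar_mx.
  rewrite -!mulmxA (mulmxA Th^T) TT mul1mx /Cbar mulmxBl mul_scalar_mx mulmxBr.
  by rewrite -scalemxAr.
pose g : R := (1 - 2 * eta) / (2 * k%:R).
pose a : R := abar - 2 * nmin%:R * q.
(* The maximum with 0 accounts for the eigenvalue [abar] on the complement of the range of [Th]. *)
pose x : R := Num.max 0 (2 * nmax%:R - n%:R).
pose b : R := abar - x * q.
have q0 := q_gt0.
have nmin0 : 0 <= nmin%:R :> R by rewrite ler0n.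
(* If the maximum is not 0, this combines [nmax + nmin <= n], valid since there are two clusters,
   with [nmax <= 2 nmin]. *)
have xn : nmin%:R <= 2 * nmin%:R - x.
  rewrite /x maxEle; case: ifP => _.
    have : (nmax + nmin)%:R <= n%:R :> R by rewrite ler_nat nmaxD_nmin.
    have : nmax%:R <= (2 * nmin)%:R :> R by rewrite ler_nat.
    by rewrite natrM natrD => h1 h2; lra.
  by rewrite subr0; lra.
have kR : 0 < k%:R :> R by rewrite ltr0n.
have gab : g <= b - a.
  apply: le_trans (_ : nmin%:R * q <= _); last first.
    have -> : b - a = (2 * nmin%:R - x) * q by rewrite /b /a; ring.
    by rewrite ler_wpM2r // ltW.
  have : n%:R <= k%:R * (2 * nmin%:R) :> R.
    by rewrite -!natrM ler_nat (leq_trans n_le_kmax) // leq_mul2l nmm orbT.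
  move=> h.
  have d0 := dbar_gt0.
  have h1 : dbar n p <= n%:R * p.
    by rewrite /dbar mulrC ler_pM2r // ler_nat leq_pred.
  have eta0 : 0 < 1 - 2 * eta by rewrite subr_gt0 mulrC -ltr_pdivlMr.
  rewrite /g ler_pdivrMr ?mulr_gt0 //.
  have -> : nmin%:R * q * (2 * k%:R) =
      (1 - 2 * eta) * (k%:R * (2 * nmin%:R) * p / dbar n p) by ring.
  rewrite ler_pMr // ler_pdivlMr // mul1r; apply: le_trans h1 _.
  by rewrite ler_wpM2r // ltW.
apply: (@davis_kahan _ _ M Lbar V0 V lam0 a b e s) => //.
- by rewrite (leq_trans (leq_pred _)) // leq_clusters.
- by move=> i; rewrite mxE; apply: (Cbar_low UU CU mono (j := last)) => /=.
(* The component of [z] in the range of [Th] has coordinates [w], and orthogonality to [Th Rk]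
   leaves [w] only its coordinate along the last eigenvector of [C]. *)
- move=> z hz; pose w := Th^T *m z; pose y := U^T *m w.
  have Rw : Rk^T *m w = 0 by rewrite mulmxA -trmx_mul.
  have wU : w = U *m y by rewrite mulmxA orthogonal_mxC // mul1mx.
  have y0 (j : 'I_k) : j != last -> y j 0 = 0.
    move=> jl; have jk : (j < k.-1)%N.
      by rewrite ltn_neqAle (jl : val j != k.-1) -ltnS prednK ?ltn_ord.
    have : (J^T *m y) (Ordinal jk) 0 = 0.
      have -> : J^T *m y = 0 by rewrite -Rw RUJ trmx_mul -mulmxA.
      by rewrite mxE.
    rewrite mxE (bigD1 j) //= big1 ?addr0 => [|l lj].
      by rewrite !mxE /= eqxx jk mul1r.
    by rewrite !mxE -[X in X && _]/(l == j) (negbTE lj) mul0r.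
  have nw : nsq w = y last 0 ^+ 2.
    rewrite wU nsq_isometry // nsqE (bigD1 last) //= big1 ?addr0 // => l ll.
    by rewrite y0 // expr0n.
  have dC : dot w (C *m w) = lam 0 last * nsq w.
    rewrite CU {1 2}wU dot_spectral // nw (bigD1 last) //= big1 ?addr0 // => l ll.
    by rewrite y0 // expr0n mulr0.
  have dB : dot w (B *m w) = (abar - lam 0 last) * nsq w.
    by move: dC; rewrite dot_Cbar => h; rewrite mulrBl -h opprB addrC subrK.
  have nwz : nsq w <= nsq z.
    have : 0 <= nsq (z - Th *m w) by exact: nsq_ge0.
    rewrite nsqD -scaleN1r dotZr nsqZ nsq_isometry // dotC dot_mulmxl -/w -/(nsq w); lra.
  have -> : dot z (Lbar *m z) = abar * nsq z - dot w (B *m w).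
    by rewrite mulmxBl mul_scalar_mx dotBr dotZr /w -!mulmxA [dot z (Th *m _)]dotC dot_mulmxl dotC.
  rewrite dB.
  have hl := Cbar_last UU CU mono (erefl (val last)).
  have hx : (abar - lam 0 last) * nsq w <= x * q * nsq w.
    rewrite ler_wpM2r ?nsq_ge0 //.
    apply: le_trans (_ : (2 * nmax%:R - n%:R) * q <= _); first lra.
    by rewrite ler_pM2r // /x le_max lexx orbT.
  have hx2 : x * q * nsq w <= x * q * nsq z.
    by rewrite ler_wpM2l // mulr_ge0 ?(ltW q0) // /x le_max lexx.
  by rewrite /b mulrBl; lra.
- by rewrite -/g in eg; lra.
- apply: le_trans es _; rewrite ler_wpM2l // -/g; lra.
Qed.
End ClusterGap.

(** * The probability space *)

Section Model.
Variables (n k : nat) (cl : 'I_n -> 'I_k) (p eta : R).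
Hypotheses (p0 : 0 <= p) (p1 : p <= 1) (eta0 : 0 <= eta) (eta1 : eta <= 1).
Local Notation pp := (pair_prob cl p eta).
Local Notation wt := (weight cl p eta).
Local Notation Pr := (Prob cl p eta).

Lemma pair_probC i j e : pp i j e = pp j i e.
Proof. by rewrite /pair_prob (eq_sym (cl i)). Qed.

Lemma pair_prob_ge0 i j e : 0 <= pp i j e.
Proof. by rewrite /pair_prob; case: ifP => _; [|case: ifP => _]; rewrite ?mulr_ge0 ?subr_ge0. Qed.

Lemma sum_I3 (F : 'I_3 -> R) : \sum_e F e = F ord0 + F (@inord 2 1) + F (@inord 2 2).
Proof.
rewrite !big_ord_recl big_ord0 addr0 addrA; congr (_ + F _ + F _).
  by apply: val_inj; rewrite /= inordK.
by apply: val_inj; rewrite /= inordK.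
Qed.

Lemma sum_pair_prob (f : 'I_3 -> R) i j : \sum_e pp i j e * f e =
  (1 - p) * f ord0 + (if cl i == cl j then p * (1 - eta) else p * eta) * f (@inord 2 1) +
  (if cl i == cl j then p * eta else p * (1 - eta)) * f (@inord 2 2).
Proof.
by rewrite sum_I3 /pair_prob !inordK //=; case: (cl i == cl j).
Qed.

(** Independence of the pairs: a valid matrix is the same as a free choice of its entries above the
    diagonal, so summing a product over valid matrices is distributivity. *)
Lemma prod_pairs_sum (F : 'I_n -> 'I_n -> 'I_3 -> R) :
  \sum_(a | valid a) \prod_(i : 'I_n) \prod_(j : 'I_n | (i < j)%N) F i j (a i j) =
  \prod_(i : 'I_n) \prod_(j : 'I_n | (i < j)%N) \sum_e F i j e.
Proof.
pose P (ij : 'I_n * 'I_n) := (ij.1 < ij.2)%N.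
rewrite [RHS]pair_big_dep /= (big_distr_big_dep ord0).
(* The default [ord0] outside the pairs [i < j] is also the value that validity imposes on the
   diagonal. *)
pose h (f : {ffun 'I_n * 'I_n -> 'I_3}) : sample n := \matrix_(i, j)
  if (i < j)%N then f (i, j) else if (j < i)%N then f (j, i) else ord0.
pose h' (a : sample n) := [ffun ij : 'I_n * 'I_n => if P ij then a ij.1 ij.2 else ord0].
rewrite (reindex_onto h h') /=; last first.
  move=> a /andP[/forallP sa /forallP da]; apply/matrixP => i j; rewrite !mxE !ffunE /P /=.
  case: ltngtP => // ij.
    by have /forallP/(_ i)/eqP := sa j.
  by rewrite (val_inj ij); apply/val_inj/esym/eqP/da.
apply: eq_big => [f|f _]; last first.
  rewrite pair_big_dep /=; apply: eq_bigr => -[i j] /= ij.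
  by rewrite mxE ij.
apply/andP/pfamilyP => [[_ /eqP hf]|[/fintype.subsetP fs _]].
  split=> //; apply/fintype.subsetP => ij; rewrite -hf !inE ffunE unfold_in.
  by rewrite /P; case: ifP => //; rewrite eqxx.
split.
  apply/andP; split; apply/forallP => i; last by rewrite mxE ltnn.
  by apply/forallP => j; rewrite !mxE; case: ltngtP.
apply/eqP/ffunP => -[i j]; rewrite ffunE /P /= mxE; case: (boolP (i < j)%N) => // ij.
apply/esym/eqP; apply: contraNT ij => fij.
by have := fs (i, j); rewrite inE => /(_ fij).
Qed.

Lemma weight_ge0 a : 0 <= wt a.
Proof.
rewrite /weight; case: ifP => // _; apply: prodr_ge0 => i _; apply: prodr_ge0 => j _.
exact: pair_prob_ge0.
Qed.

Lemma expect_prod (g : 'I_n -> 'I_n -> 'I_3 -> R) :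
  \sum_a wt a * \prod_(i : 'I_n) \prod_(j : 'I_n | (i < j)%N) g i j (a i j) =
  \prod_(i : 'I_n) \prod_(j : 'I_n | (i < j)%N) \sum_e pp i j e * g i j e.
Proof.
rewrite -prod_pairs_sum [RHS]big_mkcond; apply: eq_bigr => a _; rewrite /weight.
case: ifP => _; last by rewrite mul0r.
by rewrite -big_split; apply: eq_bigr => i _; rewrite -big_split.
Qed.

Lemma sum_weight : \sum_a wt a = 1.
Proof.
have := expect_prod (fun _ _ _ => 1).
have -> : \sum_a wt a * \prod_(i < n) \prod_(j < n | (i < j)%N) 1 = \sum_a wt a.
  by apply: eq_bigr => a _; rewrite big1 ?mulr1 // => i _; rewrite big1.
move=> ->; rewrite big1 // => i _; rewrite big1 // => j _.
rewrite (sum_pair_prob (fun=> 1)) !mulr1; case: ifP => _; ring.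
Qed.

Lemma Prob_sub (E F : sample n -> Prop) : (forall a, valid a -> E a -> F a) -> Pr E <= Pr F.
Proof.
move=> EF; rewrite /Prob !(big_mkcond (fun a => `[< _ >])); apply: ler_sum => a _.
case: asboolP => Ea; case: asboolP => Fa //; first 1 last.
  exact: weight_ge0.
by rewrite /weight; case: ifP => // va; case: Fa; apply: EF.
Qed.


Lemma Prob_setC E : Pr E + Pr (fun a => ~ E a) = 1.
Proof.
rewrite -sum_weight [RHS](bigID (fun a => `[< E a >])) /=; congr (_ + _).
by apply: eq_bigl => a; apply/asboolP/negP => h /asboolP.
Qed.

Lemma Prob_or (E F : sample n -> Prop) : Pr (fun a => E a \/ F a) <= Pr E + Pr F.
Proof.
rewrite /Prob !(big_mkcond (fun a => `[< _ >])) -big_split; apply: ler_sum => a _ /=.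
have := weight_ge0 a.
case: (asboolP (E a \/ F a)) => [[] h w0|_ w0].
- by rewrite (asboolT h) lerDl; case: ifP.
- by rewrite (asboolT h) lerDr; case: ifP.
- by rewrite addr_ge0 //; case: ifP.
Qed.

Lemma Prob_exists (I : finType) (E : I -> sample n -> Prop) :
  Pr (fun a => exists i, E i a) <= \sum_i Pr (E i).
Proof.
rewrite /Prob; under [leRHS]eq_bigr do rewrite big_mkcond.
rewrite exchange_big /= big_mkcond; apply: ler_sum => a _.
case: asboolP => [[i h]|_]; last first.
  by apply: sumr_ge0 => i _; case: ifP => // _; apply: weight_ge0.
rewrite (bigD1 i) //= asboolT // lerDl; apply: sumr_ge0 => j _.
by case: ifP => // _; apply: weight_ge0.
Qed.

(** The exponential parameter is absorbed into [g]. The indicator of [t <= S] is bounded by exp(S -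
    t), and the expectation factors over pairs. *)
Lemma chernoff (g : 'I_n -> 'I_n -> 'I_3 -> R) (c : 'I_n -> 'I_n -> R) (t : R) :
  (forall i j : 'I_n, (i < j)%N -> \sum_e pp i j e * expR (g i j e) <= expR (c i j)) ->
  Pr (fun a => t <= \sum_(i : 'I_n) \sum_(j : 'I_n | (i < j)%N) g i j (a i j)) <=
  expR (\sum_(i : 'I_n) \sum_(j : 'I_n | (i < j)%N) c i j - t).
Proof.
move=> gc; pose S a : R := \sum_(i : 'I_n) \sum_(j : 'I_n | (i < j)%N) g i j (a i j).
apply: le_trans (_ : \sum_a wt a * expR (S a - t) <= _).
  rewrite /Prob big_mkcond; apply: ler_sum => a _; case: asboolP => [h|_].
    rewrite -[leLHS]mulr1 ler_wpM2l ?weight_ge0 //.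
    by apply: le_trans (expR_ge1Dx _); rewrite lerDl subr_ge0.
  by rewrite mulr_ge0 ?weight_ge0 ?expR_ge0.
under eq_bigr do rewrite exp.expRD mulrA; rewrite -mulr_suml exp.expRD.
rewrite ler_wpM2r ?expR_ge0 //.
have -> : \sum_a wt a * expR (S a) =
    \prod_(i : 'I_n) \prod_(j : 'I_n | (i < j)%N) \sum_e pp i j e * expR (g i j e).
  rewrite -expect_prod; apply: eq_bigr => a _; congr (_ * _).
  by rewrite expR_sum; apply: eq_bigr => i _; rewrite expR_sum.
have s0 (i j : 'I_n) : 0 <= \sum_e pp i j e * expR (g i j e).
  by apply: sumr_ge0 => e _; rewrite mulr_ge0 ?pair_prob_ge0 ?expR_ge0.
rewrite expR_sum; apply: ler_prod => i _; rewrite expR_sum; apply/andP; split.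
  by apply: prodr_ge0 => j _.
by apply: ler_prod => j ij; rewrite s0 gc.
Qed.

End Model.

(** * Deterministic bounds: heavy pairs and discretization *)

Lemma amgm_weighted (th x y : R) : 0 < th -> x * y <= th / 2 * x ^+ 2 + y ^+ 2 / (2 * th).
Proof.
move=> th0; have t2 : 0 < 2 * th by lra.
rewrite -subr_ge0.
have -> : th / 2 * x ^+ 2 + y ^+ 2 / (2 * th) - x * y = (th * x - y) ^+ 2 / (2 * th).
  by field; rewrite gt_eqF.
by rewrite divr_ge0 ?sqr_ge0 // ltW.
Qed.

(* Removing vertices of small degree one by one orients the edges inside S with
   out-degrees at most 2 h, and each edge is then split by a weighted AM-GM. *)
Lemma degenerate_form (T : finType) (G : T -> T -> R) (h th : R) (x y : T -> R) (S : {set T}) :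
  (forall i j, 0 <= G i j) -> (forall i j, G i j = G j i) -> (forall i, G i i = 0) ->
  0 < th ->
  (forall S' : {set T}, S' \subset S -> S' != finset.set0 ->
     \sum_(i in S') \sum_(j in S') G i j <= 2 * h * #|S'|%:R) ->
  \sum_(i in S) \sum_(j in S) G i j * (x i * y j) <=
  \sum_(i in S) (h * th + (\sum_(j in S) G i j) / (2 * th)) * (x i ^+ 2 + y i ^+ 2).
Proof.
move=> G0 Gsym Gd th0.
elim: {S}_.+1 {-2}S (ltnSn #|S|) => // N IH S; rewrite ltnS => SN hS.
have [->|S0] := eqVneq S finset.set0; first by rewrite !big_set0.
(* The density hypothesis at [S] itself bounds the average degree by [2 h], so some vertex is below
   it. *)
have [v vS hv] : exists2 v, v \in S & \sum_(j in S) G v j <= 2 * h.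
  apply: contrapT => hn; have := hS S (fintype.subxx _) S0; apply/negP; rewrite -ltNge.
  rewrite mulr_natr -sumr_const; have [u uS] := set0Pn _ S0.
  rewrite [ltLHS](bigD1 u) // [ltRHS](bigD1 u) //=; apply: ltr_leD.
    by rewrite ltNge; apply/negP => hu; apply: hn; exists u.
  apply: ler_sum => i /andP[iS _]; rewrite leNgt; apply/negP => hi; apply: hn.
  by exists i => //; apply: ltW.
pose S' := S :\ v.
have S'S : S' \subset S by apply: subsetDl.
have S'N : (#|S'| < N)%N by move: SN; rewrite (cardsD1 v) vS.
have {}IH := IH S' S'N (fun S2 h1 => hS S2 (fintype.subset_trans h1 S'S)).
have bS (F : T -> R) : \sum_(i in S) F i = F v + \sum_(i in S') F i.
  by rewrite (big_setD1 v).
have -> : \sum_(i in S) \sum_(j in S) G i j * (x i * y j) =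
    \sum_(j in S') (G v j * (x v * y j) + G v j * (x j * y v)) +
    \sum_(i in S') \sum_(j in S') G i j * (x i * y j).
  rewrite bS bS Gd mul0r add0r big_split -addrA; congr (_ + _).
  rewrite -big_split; apply: eq_bigr => i _.
  by rewrite bS (Gsym i v).
rewrite bS.
have -> : \sum_(i in S') (h * th + (\sum_(j in S) G i j) / (2 * th)) * (x i ^+ 2 + y i ^+ 2) =
   \sum_(i in S') G v i / (2 * th) * (x i ^+ 2 + y i ^+ 2) +
   \sum_(i in S') (h * th + (\sum_(j in S') G i j) / (2 * th)) * (x i ^+ 2 + y i ^+ 2).
  rewrite -big_split; apply: eq_bigr => i _ /=; rewrite bS (Gsym i v); ring.
rewrite addrA; apply: lerD IH.
apply: le_trans (_ : \sum_(j in S') G v j * (th / 2 * (x v ^+ 2 + y v ^+ 2) +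
    (x j ^+ 2 + y j ^+ 2) / (2 * th)) <= _).
  apply: ler_sum => j _; rewrite -mulrDr ler_wpM2l //.
  have := amgm_weighted (x v) (y j) th0; have := amgm_weighted (y v) (x j) th0.
  rewrite [x j * y v]mulrC !mulrDr !mulrDl; lra.
under eq_bigr do rewrite mulrDr; rewrite big_split /=; apply: lerD; last first.
  by apply: ler_sum => j _; rewrite mulrA mulrAC.
rewrite -mulr_suml.
have q0 : 0 <= x v ^+ 2 + y v ^+ 2 by rewrite addr_ge0 ?sqr_ge0.
rewrite mulrA ler_wpM2r //.
have d0 : 0 <= \sum_(j in S) G v j by apply: sumr_ge0.
have -> : \sum_(i in S') G v i = \sum_(j in S) G v j by rewrite [RHS]bS Gd add0r.
have e0 : 0 <= (\sum_(j in S) G v j) / (2 * th) by rewrite divr_ge0 // mulr_ge0 // ltW.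
apply: le_trans (_ : h * th <= _); last by rewrite lerDl.
have -> : h * th = 2 * h * (th / 2) by field.
by rewrite ler_wpM2r // divr_ge0 // ltW.
Qed.

(** Here [z] and [w] are vectors of norm at most 2 scaled by the square root of [n], so the
    threshold [t ^ 7 / n] reads [t ^ 7]. Each of the two unbalanced cases costs 16 through the
    degrees and the balanced one 24, whence 56. *)
Lemma heavy_pairs n (G : 'I_n -> 'I_n -> R) (t : R) (z w : 'I_n -> R) :
  0 < t ->
  (forall i j, 0 <= G i j) -> (forall i j, G i j = G j i) -> (forall i, G i i = 0) ->
  (forall i, \sum_j G i j <= 4 * t ^+ 8) ->
  \sum_i z i ^+ 2 <= 4 * n%:R -> \sum_i w i ^+ 2 <= 4 * n%:R ->
  (forall S : {set 'I_n}, S != finset.set0 -> #|S|%:R * t ^+ 6 <= 8 * n%:R ->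
     \sum_(i in S) \sum_(j in S) G i j <= 2 * t ^+ 6 * #|S|%:R) ->
  \sum_i \sum_j (if t ^+ 7 < `|z i * w j| then G i j * `|z i * w j| else 0) <=
  56 * n%:R * t ^+ 7.
Proof.
move=> t0 G0 Gsym Gd hdeg hz hw hS.
pose S := [set i | (t ^+ 6 < z i ^+ 2) || (t ^+ 6 < w i ^+ 2)]%SET.
have Scard : #|S|%:R * t ^+ 6 <= 8 * n%:R.
  rewrite mulr_natl -sumr_const.
  apply: le_trans (_ : \sum_(i in S) (z i ^+ 2 + w i ^+ 2) <= _).
    apply: ler_sum => i; rewrite inE => /orP[] h.
      by have := sqr_ge0 (w i); lra.
    by have := sqr_ge0 (z i); lra.
  apply: le_trans (_ : \sum_i (z i ^+ 2 + w i ^+ 2) <= _); last by rewrite big_split /=; lra.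
  rewrite [leRHS](bigID (mem S)) /= lerDl; apply: sumr_ge0 => i _.
  by rewrite addr_ge0 ?sqr_ge0.
(* For a pair with ratio within a factor [t], the product exceeding [t ^ 7] forces both squares
   above [t ^ 6]; this places both indices in [S]. *)
have inS (u v : R) : t ^+ 7 < `|u * v| -> `|v| < t * `|u| -> t ^+ 6 < u ^+ 2.
  rewrite normrM -(real_normK (num_real u)) => h1 h2.
  have u0 : 0 <= `|u| by [].
  have : t ^+ 7 < t * `|u| ^+ 2.
    apply: lt_le_trans h1 _; rewrite expr2 mulrCA ler_wpM2l // ltW //.
  by rewrite exprS ltr_pM2l.
have step i j : (if t ^+ 7 < `|z i * w j| then G i j * `|z i * w j| else 0) <=
    G i j * z i ^+ 2 / t + G i j * w j ^+ 2 / t +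
    (if (i \in S) && (j \in S) then G i j * (`|z i| * `|w j|) else 0).
  have ti : 0 <= t^-1 by rewrite invr_ge0 ltW.
  have a0 : 0 <= G i j * z i ^+ 2 / t by apply: mulr_ge0 => //; apply: mulr_ge0 => //; exact: sqr_ge0.
  have b0 : 0 <= G i j * w j ^+ 2 / t by apply: mulr_ge0 => //; apply: mulr_ge0 => //; exact: sqr_ge0.
  have c0 : 0 <= (if (i \in S) && (j \in S) then G i j * (`|z i| * `|w j|) else 0).
    by case: ifP => // _; rewrite !mulr_ge0.
  case: ifP => [hh|_]; last by lra.
  have [h1|h1] := leP (t * `|w j|) `|z i|.
    suff : G i j * `|z i * w j| <= G i j * z i ^+ 2 / t by lra.
    rewrite -mulrA ler_wpM2l // ler_pdivlMr // normrM -(real_normK (num_real (z i))) expr2.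
    by rewrite -mulrA ler_wpM2l // mulrC.
  have [h2|h2] := leP (t * `|z i|) `|w j|.
    suff : G i j * `|z i * w j| <= G i j * w j ^+ 2 / t by lra.
    rewrite -mulrA ler_wpM2l // ler_pdivlMr // normrM -(real_normK (num_real (w j))) expr2.
    by rewrite mulrC mulrA ler_wpM2r.
  have -> : (i \in S) && (j \in S).
    by rewrite !inE (inS _ _ hh h2) /= orbC (inS (w j) (z i)) // mulrC.
  by rewrite normrM; lra.
apply: le_trans (_ : \sum_i \sum_j (G i j * z i ^+ 2 / t + G i j * w j ^+ 2 / t +
    (if (i \in S) && (j \in S) then G i j * (`|z i| * `|w j|) else 0)) <= _).
  by apply: ler_sum => i _; apply: ler_sum.
have tz : t ^+ 8 / t = t ^+ 7 by rewrite exprSr mulfK // gt_eqF.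
have t70 : 0 < t ^+ 7 by rewrite exprn_gt0.
have n0 : 0 <= n%:R :> R by rewrite ler0n.
have gen (u : 'I_n -> R) : \sum_i u i ^+ 2 <= 4 * n%:R ->
    \sum_i \sum_j G i j * u i ^+ 2 / t <= 16 * n%:R * t ^+ 7.
  move=> hu; apply: le_trans (_ : \sum_i u i ^+ 2 * (4 * t ^+ 7) <= _).
    apply: ler_sum => i _; rewrite -!mulr_suml mulrAC mulrC ler_wpM2l ?sqr_ge0 //.
    by rewrite -tz mulrA ler_wpM2r // invr_ge0 ltW.
  rewrite -mulr_suml; apply: le_trans (_ : 4 * n%:R * (4 * t ^+ 7) <= _); last by lra.
  by rewrite ler_wpM2r // mulr_ge0 // ltW.
under eq_bigr do rewrite big_split /= big_split /=.
rewrite big_split /= big_split /=.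
have h1 := gen z hz.
have h2 : \sum_i \sum_j G i j * w j ^+ 2 / t <= 16 * n%:R * t ^+ 7.
  by rewrite exchange_big /=; under eq_bigr do under eq_bigr do rewrite Gsym; apply: gen.
suff h3 : \sum_i \sum_j (if (i \in S) && (j \in S) then G i j * (`|z i| * `|w j|) else 0)
   <= 24 * n%:R * t ^+ 7 by lra.
have -> : \sum_i \sum_j (if (i \in S) && (j \in S) then G i j * (`|z i| * `|w j|) else 0) =
   \sum_(i in S) \sum_(j in S) G i j * (`|z i| * `|w j|).
  rewrite [RHS]big_mkcond; apply: eq_bigr => i _; case: ifP => iS /=.
    by rewrite [RHS]big_mkcond; apply: eq_bigr.
  by rewrite big1.
(* With [h = t ^ 6] and weight [th = t], the vertex cost is [t ^ 7] plus degree over [2 t], in all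
   at most [3 t ^ 7]; the squares sum to at most [8 n]. *)
apply: le_trans (@degenerate_form _ G (t ^+ 6) t _ _ S G0 Gsym Gd t0 _) _.
  move=> S' S'S S'0; apply: hS => //; apply: le_trans Scard.
  by rewrite ler_wpM2r ?exprn_ge0 ?(ltW t0) // ler_nat subset_leq_card.
apply: le_trans (_ : \sum_(i in S) 3 * t ^+ 7 * (z i ^+ 2 + w i ^+ 2) <= _).
  apply: ler_sum => i _; rewrite !(real_normK (num_real _)) ler_wpM2r ?addr_ge0 ?sqr_ge0 //.
  have -> : t ^+ 6 * t = t ^+ 7 by rewrite -exprSr.
  suff : (\sum_(j in S) G i j) / (2 * t) <= 2 * t ^+ 7 by lra.
  rewrite ler_pdivrMr ?mulr_gt0 //.
  apply: le_trans (_ : \sum_j G i j <= _).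
    by rewrite [leRHS](bigID (mem S)) /= lerDl sumr_ge0.
  apply: le_trans (hdeg i) _; rewrite [t ^+ 8]exprSr; lra.
have t73 : 0 <= 3 * t ^+ 7 by lra.
rewrite -mulr_sumr; apply: le_trans (_ : 3 * t ^+ 7 * (\sum_i (z i ^+ 2 + w i ^+ 2)) <= _).
  rewrite ler_wpM2l // [leRHS](bigID (mem S)) /= lerDl sumr_ge0 // => i _.
  by rewrite addr_ge0 ?sqr_ge0.
rewrite big_split /=; set A := \sum_i _ in hz *; set B := \sum_i _ in hw *.
apply: le_trans (_ : 3 * t ^+ 7 * (8 * n%:R) <= _); last by lra.
by rewrite ler_wpM2l //; lra.
Qed.

(** Integer vectors as sign and magnitude, which gives a finite type. A vector with squared norm at
    most [4 n] has entries at most [4 n], so none is lost; zero has two codes, which only enlarges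
    the count. *)
Definition grid (n : nat) := {ffun 'I_n -> bool * 'I_(4 * n).+1}.

Definition gval (n : nat) (z : grid n) (i : 'I_n) : R :=
  if (z i).1 then ((z i).2)%:R else - ((z i).2)%:R.

Lemma round_real (c x : R) :
  exists v : int, c * x <= c * v%:~R /\ (v%:~R : R) ^+ 2 <= 2 * x ^+ 2 + 2.
Proof.
have h1 := ge_floor x; have h2 := floorD1_gt x.
have sq (v : R) : x - 1 <= v -> v <= x + 1 -> v ^+ 2 <= 2 * x ^+ 2 + 2.
  move=> l1 l2; have h : 0 <= (v - (x - 1)) * (x + 1 - v) by rewrite mulr_ge0 ?subr_ge0.
  have := sqr_ge0 (2 * x - v); lra.
have [c0|c0] := leP 0 c.
  exists (Num.floor x + 1); split; first by rewrite ler_wpM2l // ltW.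
  by move: h2; rewrite intrD => h2; apply: sq; lra.
exists (Num.floor x); split; first by rewrite ler_wnM2l // ltW.
by move: h2; rewrite intrD => h2; apply: sq; lra.
Qed.

(* A linear form is not decreased when each coordinate is rounded in the
   direction of its coefficient, so no epsilon is lost in the discretization. *)
Lemma round_linear n (c x : 'I_n -> R) : \sum_i x i ^+ 2 <= n%:R ->
  exists2 z : grid n, \sum_i gval z i ^+ 2 <= 4 * n%:R &
    \sum_i c i * x i <= \sum_i c i * gval z i.
Proof.
move=> hx.
have [v hv] := fin_all_exists (fun i => round_real (c i) (x i)).
have vs : \sum_i (v i)%:~R ^+ 2 <= 4 * n%:R :> R.
  apply: le_trans (_ : \sum_i (2 * x i ^+ 2 + 2) <= _).
    by apply: ler_sum => i _; case: (hv i).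
  rewrite big_split /= -mulr_sumr sumr_const card_ord -[2 *+ n]mulr_natr; lra.
have vb i : (`|v i|%N < (4 * n).+1)%N.
  rewrite ltnS -(ler_nat R) natrM.
  apply: le_trans vs; rewrite (bigD1 i) //=.
  apply: le_trans (_ : (v i)%:~R ^+ 2 <= _); last first.
    by rewrite lerDl sumr_ge0 // => j _; rewrite sqr_ge0.
  have -> : (v i)%:~R ^+ 2 = (`|v i| ^ 2)%:R :> R.
    by rewrite natrX natr_absz intr_norm real_normK ?num_real.
  by rewrite ler_nat; case: `|v i|%N => // m; rewrite leq_pmulr.
pose z : grid n := [ffun i => (0 <= v i, inord `|v i|%N)].
have zv i : gval z i = (v i)%:~R.
  rewrite /gval ffunE /= inordK // natr_absz.
  by case: ifP => [/ger0_norm->|/negbT]; rewrite -?ltNge // => /ltr0_norm->; rewrite intrN opprK.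
exists z; first by rewrite (eq_bigr (fun i => (v i)%:~R ^+ 2)) // => i _; rewrite zv.
by apply: ler_sum => i _; rewrite zv; case: (hv i).
Qed.

(** The form is linear in each argument, so the arguments are rounded one after the other. Taking
    [W x] and [x], both rescaled to squared norm [n], turns the form into [n] times the ratio of
    their norms. *)
Lemma opnorm_le_grid n (W : 'M[R]_n) (K : R) : 0 <= K ->
  (forall z w : grid n, \sum_i gval z i ^+ 2 <= 4 * n%:R -> \sum_i gval w i ^+ 2 <= 4 * n%:R ->
     \sum_i \sum_j W i j * (gval z i * gval w j) <= K * n%:R) ->
  opnorm_le W K.
Proof.
move=> K0 hW x.
have real (a b : 'I_n -> R) : \sum_i a i ^+ 2 <= n%:R -> \sum_i b i ^+ 2 <= n%:R ->
    \sum_i \sum_j W i j * (a i * b j) <= K * n%:R.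
  move=> ha hb.
  have [z hz h1] := round_linear (fun i => \sum_j W i j * b j) ha.
  have [w hw h2] := round_linear (fun j => \sum_i W i j * gval z i) hb.
  apply: le_trans (hW z w hz hw).
  apply: le_trans (_ : \sum_i \sum_j W i j * (gval z i * b j) <= _).
    have e (u : 'I_n -> R) : \sum_i \sum_j W i j * (u i * b j) =
        \sum_i (\sum_j W i j * b j) * u i.
      by apply: eq_bigr => i _; rewrite mulr_suml; apply: eq_bigr => j _; ring.
    by rewrite !e.
  have e (u : 'I_n -> R) : \sum_i \sum_j W i j * (gval z i * u j) =
      \sum_j (\sum_i W i j * gval z i) * u j.
    by rewrite exchange_big; apply: eq_bigr => i _; rewrite mulr_suml; apply: eq_bigr => j _; ring.
  by rewrite !e.
have [->|x0] := eqVneq x 0; first by rewrite mulmx0 !euclid0 mulr0.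
have [->|y0] := eqVneq (W *m x) 0; first by rewrite euclid0 mulr_ge0 ?euclid_ge0.
set y := W *m x in y0 *.
have ex := euclid_gt0 x0; have ey := euclid_gt0 y0.
have n0 : 0 < n%:R :> R.
  rewrite ltr0n; case: (n) W x hW real x0 y y0 ex ey => // W' x' _ _.
  by move=> /eqP[]; apply/matrixP => -[].
pose q := Num.sqrt (n%:R : R).
have q0 : 0 < q by rewrite sqrtr_gt0.
have qq : q ^+ 2 = n%:R by rewrite sqr_sqrtr // ltW.
have sc (u : 'cV[R]_n) : 0 < euclid u -> \sum_i (q / euclid u * u i 0) ^+ 2 <= n%:R.
  move=> u0; under eq_bigr do rewrite exprMn; rewrite -mulr_sumr -nsqE -sqr_euclid -exprMn.
  by rewrite divfK ?gt_eqF // qq.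
have := real (fun i => q / euclid y * y i 0) (fun j => q / euclid x * x j 0) (sc _ ey) (sc _ ex).
have -> : \sum_i \sum_j W i j * (q / euclid y * y i 0 * (q / euclid x * x j 0)) =
    n%:R * (euclid y / euclid x).
  rewrite -qq; transitivity (q ^+ 2 / (euclid x * euclid y) * nsq y).
    rewrite /nsq dotE mulr_sumr; apply: eq_bigr => i _.
    have -> : y i 0 * y i 0 = y i 0 * \sum_j W i j * x j 0 by rewrite {2}/y mxE.
    rewrite !mulr_sumr; apply: eq_bigr => j _.
    by field; rewrite !gt_eqF.
  by rewrite -sqr_euclid; field; rewrite !gt_eqF.
rewrite mulrC ler_pM2r // ler_pdivrMr //.
Qed.

(** * Tail bounds *)

(** From exp(-u) >= 1 - u, inverted; the quadratic times [1 - u] is [1 + u ^ 2 * (1 - 2 * u)], at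
    least 1. *)
Lemma expR_quadratic (u : R) : u <= 1 / 2 -> expR u <= 1 + u + 2 * u ^+ 2.
Proof.
move=> hu; have h := expR_ge1Dx (- u); have e0 := expR_gt0 (- u).
have -> : expR u = (expR (- u))^-1 by rewrite expRN invrK.
have d0 : 0 < 1 - u by lra.
apply: le_trans (_ : (1 - u)^-1 <= _).
  by rewrite lef_pV2 ?posrE.
rewrite -[leLHS]mul1r ler_pdivrMr //.
have : 0 <= u ^+ 2 * (1 - 2 * u) by rewrite mulr_ge0 ?sqr_ge0 //; lra.
lra.
Qed.

Lemma expR_half_le2 : expR (1 / 2 : R) <= 2.
Proof.
have h := expR_ge1Dx (- (1 / 2) : R); have e0 := expR_gt0 (- (1 / 2) : R).
have -> : expR (1 / 2 : R) = (expR (- (1 / 2) : R))^-1 by rewrite expRN invrK.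
by rewrite -[leLHS]mul1r ler_pdivrMr //; lra.
Qed.

Lemma expR1_ge2 : 2 <= expR (1 : R).
Proof. by have := expR_ge1Dx (1 : R); lra. Qed.

Lemma sum_sym n (F : 'I_n -> 'I_n -> R) : \sum_i \sum_j F i j =
  \sum_(i : 'I_n) \sum_(j : 'I_n | (i < j)%N) (F i j + F j i) + \sum_i F i i.
Proof.
have -> : \sum_(i : 'I_n) \sum_(j : 'I_n | (i < j)%N) (F i j + F j i) =
    \sum_(i : 'I_n) \sum_(j : 'I_n | (i < j)%N) F i j +
    \sum_(i : 'I_n) \sum_(j : 'I_n | (j < i)%N) F i j.
  under eq_bigr do rewrite big_split; rewrite big_split /=; congr (_ + _).
  rewrite (exchange_big_dep xpredT) //=.
rewrite -!big_split; apply: eq_bigr => i _ /=.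
rewrite (bigID (fun j : 'I_n => (i < j)%N)) /= -addrA; congr (_ + _).
rewrite (bigD1 i) /=; last by rewrite ltnn.
rewrite addrC; congr (_ + _); apply: eq_bigl => j.
by rewrite -leqNgt ltn_neqAle andbC.
Qed.

Lemma norm_sign_of e : `|sign_of e| = ((e : nat) != 0%N)%:R.
Proof. by rewrite /sign_of; case: eqP => _; rewrite ?normr0 //; case: eqP; rewrite ?normrN1 ?normr1. Qed.

Section Mean.
Variables (n k : nat) (cl : 'I_n -> 'I_k).

Definition edge_mean (p eta : R) (f : 'I_3 -> R) (i j : 'I_n) : R :=
  \sum_e pair_prob cl p eta i j e * f e.

(** Kept generic in [f] so that one argument covers both the signed matrix ([sign_of]) and the
    unsigned one ([edge_of]). *)
Definition noise_mx (p eta : R) (f : 'I_3 -> R) (a : sample n) : 'M[R]_n :=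
  \matrix_(i, j) (if i == j then 0 else f (a i j) - edge_mean p eta f i j).

Lemma pair_prob_split (p eta : R) i j : 0 <= p -> 0 <= eta -> eta <= 1 ->
  exists A B : R, [/\ 0 <= A, 0 <= B, A + B = p &
   forall f : 'I_3 -> R, \sum_e pair_prob cl p eta i j e * f e =
    (1 - p) * f ord0 + A * f (@inord 2 1) + B * f (@inord 2 2)].
Proof.
move=> p0 e0 e1; have e2 : 0 <= 1 - eta by lra.
exists (if cl i == cl j then p * (1 - eta) else p * eta).
exists (if cl i == cl j then p * eta else p * (1 - eta)).
split; [| | |by move=> f; rewrite sum_pair_prob]; case: ifP => _; rewrite ?mulr_ge0 //; ring.
Qed.

(** [f] vanishes on absent edges, so the variance is at most [p]. The centered variable is at most 2
    in absolute value, so [|u| <= 1 / 4] keeps the exponent within the range of [expR_quadratic]. *)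
Lemma moment_bound (p eta : R) (f : 'I_3 -> R) i j (u : R) :
  0 <= p -> p <= 1 -> 0 <= eta -> eta <= 1 -> (forall e, `|f e| <= `|sign_of e|) ->
  `|u| <= 1 / 4 ->
  \sum_e pair_prob cl p eta i j e * expR (u * (f e - edge_mean p eta f i j)) <=
  expR (2 * p * u ^+ 2).
Proof.
move=> p0 p1 e0 e1 hf hu.
have [A [B [A0 B0 AB hs]]] := pair_prob_split i j p0 e0 e1.
rewrite /edge_mean !hs.
have f0 : f ord0 = 0 by apply/eqP; have := hf ord0; rewrite norm_sign_of normr_le0.
have f1 : `|f (@inord 2 1)| <= 1 by have := hf (@inord 2 1); rewrite norm_sign_of inordK.
have f2 : `|f (@inord 2 2)| <= 1 by have := hf (@inord 2 2); rewrite norm_sign_of inordK.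
move: f1 f2; set f1 := f (@inord 2 1); set f2 := f (@inord 2 2) => hf1 hf2.
pose mu : R := A * f1 + B * f2.
have emu : 0 + A * f1 + B * f2 = mu by rewrite add0r.
rewrite f0 mulr0 emu.
have hmu : `|mu| <= 1.
  apply: le_trans (_ : A + B <= 1); last by lra.
  apply: le_trans (ler_normD _ _) _; rewrite !normrM (ger0_norm A0) (ger0_norm B0).
  by apply: lerD; rewrite -[leRHS]mulr1 ler_wpM2l.
have bd (x : R) : `|x| <= 1 ->
    expR (u * (x - mu)) <= 1 + u * (x - mu) + 2 * (u * (x - mu)) ^+ 2.
  move=> hx; apply: expR_quadratic.
  have hd : `|x - mu| <= 2 by apply: le_trans (ler_normB _ _) _; lra.
  apply: le_trans (ler_norm _) _; rewrite normrM.
  apply: le_trans (_ : 1 / 4 * 2 <= _); last by lra.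
  by apply: ler_pM.
apply: le_trans (_ : 1 + 2 * p * u ^+ 2 <= _); last exact: expR_ge1Dx.
have b0 := bd 0; rewrite normr0 in b0; have {}b0 := b0 ler01.
have b1 := bd f1 hf1; have b2 := bd f2 hf2.
have c0 : (1 - p) * expR (u * (0 - mu)) <=
   (1 - p) * (1 + u * (0 - mu) + 2 * (u * (0 - mu)) ^+ 2) by rewrite ler_wpM2l // subr_ge0.
have c1 : A * expR (u * (f1 - mu)) <= A * (1 + u * (f1 - mu) + 2 * (u * (f1 - mu)) ^+ 2).
  by rewrite ler_wpM2l.
have c2 : B * expR (u * (f2 - mu)) <= B * (1 + u * (f2 - mu) + 2 * (u * (f2 - mu)) ^+ 2).
  by rewrite ler_wpM2l.
apply: le_trans (lerD (lerD c0 c1) c2) _.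
have s1 : A * f1 ^+ 2 <= A by rewrite -[leRHS]mulr1 ler_wpM2l // -real_normK ?num_real // expr_le1.
have s2 : B * f2 ^+ 2 <= B by rewrite -[leRHS]mulr1 ler_wpM2l // -real_normK ?num_real // expr_le1.
have : 0 <= 2 * u ^+ 2 * (p - A * f1 ^+ 2 - B * f2 ^+ 2 + mu ^+ 2).
  apply: mulr_ge0; first by rewrite mulr_ge0 // sqr_ge0.
  by have := sqr_ge0 mu; lra.
rewrite /mu -AB; lra.
Qed.

Lemma edge_meanC p eta f i j : edge_mean p eta f i j = edge_mean p eta f j i.
Proof. by apply: eq_bigr => e _; rewrite pair_probC. Qed.

(** Dividing by [8 T] makes every coefficient at most [1 / 4]. The threshold becomes [15 n], while
    the quadratic moments add up to at most [n] because [p n <= T ^ 2]. The remaining [14 n] beats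
    the [12 n] of entropy of pairs of grid vectors. *)
Lemma light_tail (p eta T : R) (f : 'I_3 -> R) (z w : 'I_n -> R) :
  0 <= p -> p <= 1 -> 0 <= eta -> eta <= 1 -> (forall e, `|f e| <= `|sign_of e|) ->
  0 < T -> p * n%:R <= T ^+ 2 ->
  \sum_i z i ^+ 2 <= 4 * n%:R -> \sum_i w i ^+ 2 <= 4 * n%:R ->
  Prob cl p eta (fun a => 120 * T * n%:R <= \sum_i \sum_j
    noise_mx p eta f a i j * (if `|z i * w j| <= T then z i * w j else 0)) <=
  expR (- (14 * n%:R)).
Proof.
move=> p0 p1 e0 e1 hf T0 pT hz hw.
pose b i j := if `|z i * w j| <= T then z i * w j else 0.
have bT i j : `|b i j| <= T by rewrite /b; case: ifP => // _; rewrite normr0 ltW.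
pose u i j := (8 * T)^-1 * (b i j + b j i).
have l0 : 0 < (8 * T)^-1 by rewrite invr_gt0 mulr_gt0.
have hu i j : `|u i j| <= 1 / 4.
  rewrite /u normrM gtr0_norm // ler_pdivrMl ?mulr_gt0 //.
  by apply: le_trans (ler_normD _ _) _; have := bT i j; have := bT j i; lra.
pose g i j e := u i j * (f e - edge_mean p eta f i j).
pose c i j := 2 * p * u i j ^+ 2.
apply: le_trans (_ : expR (\sum_(i : 'I_n) \sum_(j : 'I_n | (i < j)%N) c i j - 15 * n%:R) <= _).
  apply: le_trans (chernoff p0 p1 e0 e1 (g := g) _ _); last first.
    by move=> i j _; apply: moment_bound.
  apply: (Prob_sub cl p0 p1 e0 e1) => a /andP[/forallP sa _].
  rewrite sum_sym [X in _ + X]big1 ?addr0; last by move=> i _; rewrite mxE eqxx mul0r.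
  have -> : \sum_(i : 'I_n) \sum_(j : 'I_n | (i < j)%N)
      (noise_mx p eta f a i j * b i j + noise_mx p eta f a j i * b j i) =
     8 * T * \sum_(i : 'I_n) \sum_(j : 'I_n | (i < j)%N) g i j (a i j).
    rewrite mulr_sumr; apply: eq_bigr => i _; rewrite mulr_sumr; apply: eq_bigr => j ij.
    have nij : i != j by rewrite -val_eqE /= ltn_eqF.
    rewrite !mxE (negbTE nij) eq_sym (negbTE nij) /g /u.
    have /forallP/(_ j)/eqP <- := sa i; rewrite (edge_meanC _ _ _ j i).
    by field; rewrite gt_eqF.
  by rewrite -[120]/((8 * 15)%:R) natrM -!mulrA ler_pM2l // mulrCA ler_pM2l.
rewrite ler_expR.
suff : \sum_(i : 'I_n) \sum_(j : 'I_n | (i < j)%N) c i j <= n%:R by lra.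
have T80 : (8 * T)^-1 ^+ 2 = (64 * T ^+ 2)^-1 by field; rewrite gt_eqF.
have T64 : 0 <= (64 * T ^+ 2)^-1 by rewrite invr_ge0 mulr_ge0 // sqr_ge0.
have k0 : 0 <= 2 * p * (64 * T ^+ 2)^-1 by apply: mulr_ge0 => //; apply: mulr_ge0.
have k1 : 0 <= 4 * p * (64 * T ^+ 2)^-1 by apply: mulr_ge0 => //; apply: mulr_ge0.
apply: le_trans (_ : 4 * p * (64 * T ^+ 2)^-1 * \sum_i \sum_j (b i j) ^+ 2 <= _).
  rewrite [X in _ * X]sum_sym mulrDr -[leLHS]addr0; apply: lerD; last first.
    by apply: mulr_ge0 => //; apply: sumr_ge0 => i _; rewrite sqr_ge0.
  rewrite mulr_sumr; apply: ler_sum => i _; rewrite mulr_sumr; apply: ler_sum => j _.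
  rewrite /c /u exprMn T80.
  have : 0 <= 2 * p * (64 * T ^+ 2)^-1 * (b i j - b j i) ^+ 2.
    by apply: mulr_ge0 => //; apply: sqr_ge0.
  lra.
have hb : \sum_i \sum_j (b i j) ^+ 2 <= 16 * n%:R ^+ 2.
  apply: le_trans (_ : (\sum_i z i ^+ 2) * (\sum_j w j ^+ 2) <= _).
    rewrite mulr_suml; apply: ler_sum => i _; rewrite mulr_sumr; apply: ler_sum => j _.
    by rewrite /b; case: ifP => _; rewrite ?exprMn // expr0n mulr_ge0 ?sqr_ge0.
  have -> : 16 * n%:R ^+ 2 = (4 * n%:R) * (4 * n%:R) :> R by ring.
  by apply: ler_pM => //; apply: sumr_ge0 => i _; rewrite sqr_ge0.
apply: le_trans (_ : 4 * p * (64 * T ^+ 2)^-1 * (16 * n%:R ^+ 2) <= _).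
  by rewrite ler_wpM2l.
have -> : 4 * p * (64 * T ^+ 2)^-1 * (16 * n%:R ^+ 2) = n%:R * (p * n%:R / T ^+ 2).
  by field; rewrite gt_eqF.
rewrite -[leRHS]mulr1 ler_wpM2l // ler_pdivrMr ?mul1r // exprn_gt0 //.
Qed.

End Mean.

(** * Entropy of the grid, light pairs and degrees *)

Lemma sum_expR_sqr m : \sum_(l < m) expR (- (l%:R ^+ 2) : R) <= 2.
Proof.
apply: le_trans (_ : \sum_(l < m) (2^-1 : R) ^+ l <= _).
  apply: ler_sum => l _.
  have -> : (2^-1 : R) ^+ l = ((2 : R) ^+ l)^-1 by rewrite exprVn.
  rewrite expRN lef_pV2 ?posrE ?expR_gt0 ?exprn_gt0 //.
  apply: le_trans (_ : expR (1 : R) ^+ l <= _).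
    by rewrite lerXn2r ?nnegrE ?expR_ge0 // expR1_ge2.
  rewrite -expRM_natl mulr1 ler_expR -natrX ler_nat.
  by case: (nat_of_ord l) => // q; rewrite leq_pmulr.
suff -> : \sum_(l < m) (2^-1 : R) ^+ l = 2 - 2 * 2^-1 ^+ m.
  have : 0 <= (2^-1 : R) ^+ m by apply: exprn_ge0; rewrite invr_ge0.
  by lra.
elim: m => [|m IH]; first by rewrite big_ord0 expr0; ring.
by rewrite big_ord_recr /= IH exprS; field.
Qed.

(** A soft count: each vector of squared norm at most [4 n] contributes at least 1. The sum over all
    vectors factors over coordinates, each factor being at most exp(4) times 4, and 4 is at most
    exp(2). *)
Lemma grid_count n :
  \sum_(z : grid n) expR (4 * n%:R - \sum_i gval z i ^+ 2) <= expR (6 * n%:R).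
Proof.
under eq_bigr do rewrite exp.expRD -sumrN expR_sum.
rewrite -mulr_sumr.
have -> : 6 * n%:R = 4 * n%:R + n%:R * 2 :> R by ring.
rewrite exp.expRD ler_wpM2l ?expR_ge0 //.
pose v (c : bool * 'I_(4 * n).+1) : R := if c.1 then (c.2)%:R else - (c.2)%:R.
rewrite -(bigA_distr_bigA (fun (i : 'I_n) c => expR (- v c ^+ 2))) /= prodr_const card_ord.
rewrite expRM_natl lerXn2r ?nnegrE ?expR_ge0 //.
  by apply: sumr_ge0 => c _; apply: expR_ge0.
have -> : \sum_c expR (- v c ^+ 2) =
    \sum_(b : bool) \sum_(l < (4 * n).+1) expR (- (l%:R ^+ 2) : R).
  rewrite pair_bigA /=; apply: eq_bigr => -[[] l] _; rewrite /v //=.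
  by rewrite sqrrN.
rewrite big_bool /=; have h := sum_expR_sqr (4 * n).+1.
apply: le_trans (_ : 2 * 2 <= _); first by lra.
have -> : expR 2 = expR 1 * expR 1 :> R by rewrite -exp.expRD.
by apply: ler_pM => //; exact: expR1_ge2.
Qed.

Section Tails.
Variables (n k : nat) (cl : 'I_n -> 'I_k).

Lemma Prob_empty (p eta : R) (E : sample n -> Prop) : (forall a, ~ E a) -> Prob cl p eta E = 0.
Proof. by move=> h; rewrite /Prob big1 // => a /asboolP /h. Qed.

Definition light_bad (p eta T : R) (f : 'I_3 -> R) (a : sample n) : Prop :=
  exists z w : grid n, [/\ \sum_i gval z i ^+ 2 <= 4 * n%:R, \sum_i gval w i ^+ 2 <= 4 * n%:R &
    120 * T * n%:R <= \sum_i \sum_j noise_mx cl p eta f a i j *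
      (if `|gval z i * gval w j| <= T then gval z i * gval w j else 0)].

Lemma Prob_light_bad (p eta T : R) (f : 'I_3 -> R) :
  0 <= p -> p <= 1 -> 0 <= eta -> eta <= 1 -> (forall e, `|f e| <= `|sign_of e|) ->
  0 < T -> p * n%:R <= T ^+ 2 ->
  Prob cl p eta (light_bad p eta T f) <= expR (- (2 * n%:R)).
Proof.
move=> p0 p1 e0 e1 hf T0 pT.
apply: le_trans (Prob_exists cl p0 p1 e0 e1 _) _.
pose Z (z : grid n) := expR (4 * n%:R - \sum_i gval z i ^+ 2).
(* The weights [Z] are at least 1 on admissible vectors, and inadmissible ones have an empty event,
   so the sum may range over the whole grid. *)
apply: le_trans (_ : \sum_(z : grid n) \sum_(w : grid n) Z z * Z w * expR (- (14 * n%:R)) <= _).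
  apply: ler_sum => z _; apply: le_trans (Prob_exists cl p0 p1 e0 e1 _) _.
  apply: ler_sum => w _.
  have rhs0 : 0 <= Z z * Z w * expR (- (14 * n%:R)) by rewrite !mulr_ge0 ?expR_ge0.
  have [hz|hz] := leP (\sum_i gval z i ^+ 2) (4 * n%:R); last first.
    by rewrite Prob_empty // => a [].
  have [hw|hw] := leP (\sum_i gval w i ^+ 2) (4 * n%:R); last first.
    by rewrite Prob_empty // => a [].
  apply: le_trans (_ : expR (- (14 * n%:R)) <= _).
    apply: le_trans (light_tail cl p0 p1 e0 e1 hf T0 pT hz hw).
    by apply: (Prob_sub cl p0 p1 e0 e1) => a _ [].
  rewrite -[leLHS]mul1r ler_wpM2r ?expR_ge0 // -[leLHS]mul1r.
  by apply: ler_pM => //; apply: le_trans (expR_ge1Dx _); rewrite lerDl subr_ge0.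
have -> : \sum_(z : grid n) \sum_(w : grid n) Z z * Z w * expR (- (14 * n%:R)) =
   (\sum_z Z z) * (\sum_z Z z) * expR (- (14 * n%:R)).
  rewrite mulr_suml mulr_suml; apply: eq_bigr => z _.
  by rewrite mulr_sumr mulr_suml.
have -> : - (2 * n%:R) = 6 * n%:R + 6 * n%:R - 14 * n%:R :> R by ring.
rewrite !exp.expRD ler_wpM2r ?expR_ge0 //.
have Z0 : 0 <= \sum_z Z z by apply: sumr_ge0 => z _; apply: expR_ge0.
by apply: ler_pM => //; apply: grid_count.
Qed.

Lemma edge_moment (p eta m : R) i j : 0 <= p -> 0 <= eta -> eta <= 1 ->
  \sum_e pair_prob cl p eta i j e * expR (m * `|sign_of e|) <= expR (p * (expR m - 1)).
Proof.
move=> p0 e0 e1; have [A [B [A0 B0 AB ->]]] := pair_prob_split cl i j p0 e0 e1.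
rewrite !norm_sign_of !inordK //= mulr0 exp.expR0 !mulr1.
apply: le_trans (expR_ge1Dx _); rewrite -AB; lra.
Qed.

Lemma sum_edges (c : 'I_n -> 'I_n -> R) (a : sample n) : valid a ->
  \sum_i \sum_j c i j * `|Amx a i j| =
  \sum_(i : 'I_n) \sum_(j : 'I_n | (i < j)%N) (c i j + c j i) * `|sign_of (a i j)|.
Proof.
move=> /andP[/forallP sa /forallP da]; rewrite sum_sym [X in _ + X]big1 ?addr0.
  apply: eq_bigr => i _; apply: eq_bigr => j _; rewrite !mxE mulrDl.
  by have /forallP/(_ j)/eqP <- := sa i.
by move=> i _; rewrite mxE norm_sign_of (eqP (da i)) mulr0.
Qed.

Lemma sum_star (i : 'I_n) :
  \sum_(i' : 'I_n) \sum_(j' : 'I_n | (i' < j')%N) ((i' == i)%:R + (j' == i)%:R) = (n.-1)%:R :> R.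
Proof.
have h : \sum_(i' : 'I_n) \sum_(j' : 'I_n) (i' == i)%:R = n%:R :> R.
  rewrite (bigD1 i) //= eqxx sumr_const card_ord big1 ?addr0 // => l li.
  by rewrite (negbTE li) big1.
move: h; rewrite sum_sym.
have -> : \sum_(l < n) ((l == i)%:R : R) = 1.
  by rewrite (bigD1 i) //= eqxx big1 ?addr0 // => l /negbTE ->.
move=> h; apply: (addIr (1 : R)); rewrite h.
by rewrite natr1 prednK // (leq_ltn_trans _ (ltn_ord i)).
Qed.

Lemma deg_edges (a : sample n) (i : 'I_n) : valid a -> deg a i =
  \sum_(i' : 'I_n) \sum_(j' : 'I_n | (i' < j')%N)
    ((i' == i)%:R + (j' == i)%:R) * `|sign_of (a i' j')|.
Proof.
move=> va; rewrite -(sum_edges (fun i' _ => (i' == i)%:R)) //.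
rewrite (bigD1 i) //= eqxx [X in _ + X]big1 ?addr0 => [|l /negbTE ->].
  by apply: eq_bigr => j _; rewrite mul1r.
by rewrite big1 // => j _; rewrite mul0r.
Qed.

Lemma star_coef (i i' j' : 'I_n) : (i' < j')%N ->
  (i' == i)%:R + (j' == i)%:R = 0 :> R \/ (i' == i)%:R + (j' == i)%:R = 1 :> R.
Proof.
move=> ij; case: (eqVneq i' i) => [<-|_]; case: eqP => [e|_].
- by move: ij; rewrite e ltnn.
- by right; rewrite addr0.
- by right; rewrite add0r.
- by left; rewrite addr0.
Qed.

(** Exponential parameter [1 / 2]: as exp(1/2) - 1 is at most 1, the moment costs [d] against the
    threshold [2 d]. *)
Lemma Prob_deg_large (p eta : R) i : 0 <= p -> p <= 1 -> 0 <= eta -> eta <= 1 ->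
  Prob cl p eta (fun a => 4 * dbar n p <= deg a i) <= expR (- dbar n p).
Proof.
move=> p0 p1 e0 e1.
pose s (i' j' : 'I_n) : R := (i' == i)%:R + (j' == i)%:R.
apply: le_trans (_ : expR (\sum_(i' : 'I_n) \sum_(j' : 'I_n | (i' < j')%N) p * s i' j'
    - 2 * dbar n p) <= _); last first.
  rewrite ler_expR; under eq_bigr do rewrite -mulr_sumr.
  rewrite -mulr_sumr sum_star -/(dbar n p); lra.
apply: le_trans (chernoff p0 p1 e0 e1 (g := fun i' j' e => 1 / 2 * s i' j' * `|sign_of e|)
   (2 * dbar n p) _).
  apply: (Prob_sub cl p0 p1 e0 e1) => a va; rewrite deg_edges // => h.
  under eq_bigr do under eq_bigr do rewrite -mulrA.
  by under eq_bigr do rewrite -mulr_sumr; rewrite -mulr_sumr; rewrite /s; lra.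
move=> i' j' ij; apply: le_trans (edge_moment _ _ _ p0 e0 e1) _.
rewrite ler_expR ler_wpM2l //; case: (star_coef i ij) => h; rewrite /s h.
  by rewrite mulr0 exp.expR0 subrr.
by rewrite mulr1; have := expR_half_le2; lra.
Qed.

(** Exponential parameter [-1]: as exp(-1) - 1 is at most [- 1 / 2], the moment gives [- d / 2]
    against the threshold [- d / 4]. *)
Lemma Prob_deg_small (p eta : R) i : 0 <= p -> p <= 1 -> 0 <= eta -> eta <= 1 ->
  Prob cl p eta (fun a => deg a i <= dbar n p / 4) <= expR (- (dbar n p / 4)).
Proof.
move=> p0 p1 e0 e1.
pose s (i' j' : 'I_n) : R := (i' == i)%:R + (j' == i)%:R.
apply: le_trans (_ : expR (\sum_(i' : 'I_n) \sum_(j' : 'I_n | (i' < j')%N) - (p / 2) * s i' j'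
    - (- (dbar n p / 4))) <= _); last first.
  rewrite ler_expR; under eq_bigr do rewrite -mulr_sumr.
  rewrite -mulr_sumr sum_star.
  have -> : - (p / 2) * n.-1%:R = - (dbar n p / 2) by rewrite /dbar; ring.
  lra.
apply: le_trans (chernoff p0 p1 e0 e1 (g := fun i' j' e => - s i' j' * `|sign_of e|)
   (- (dbar n p / 4)) _).
  apply: (Prob_sub cl p0 p1 e0 e1) => a va; rewrite deg_edges // => h.
  under eq_bigr do under eq_bigr do rewrite mulNr.
  by under eq_bigr do rewrite sumrN; rewrite sumrN lerN2.
move=> i' j' ij; apply: le_trans (edge_moment _ _ _ p0 e0 e1) _.
rewrite ler_expR mulNr -mulrN -mulrA ler_wpM2l //; case: (star_coef i ij) => h; rewrite /s h.
  by rewrite oppr0 mulr0 exp.expR0 subrr.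
rewrite expRN; have := expR1_ge2 => h2.
suff : (expR 1)^-1 <= 2^-1 :> R by lra.
by rewrite lef_pV2 ?posrE ?expR_gt0.
Qed.

End Tails.

(** * Edge density of small vertex sets *)

Lemma subset_sum n (S : {set 'I_n}) (F : 'I_n -> 'I_n -> R) :
  \sum_(i in S) \sum_(j in S) F i j = \sum_i \sum_j (if (i \in S) && (j \in S) then 1 else 0) * F i j.
Proof.
rewrite big_mkcond; apply: eq_bigr => i _; case: ifP => iS /=; last first.
  by rewrite big1 // => j _; rewrite mul0r.
by rewrite big_mkcond; apply: eq_bigr => j _; case: ifP => _; rewrite ?mul1r ?mul0r.
Qed.

Section Dense.
Variables (n k : nat) (cl : 'I_n -> 'I_k).

(** The double sum counts each edge twice, so [2 * h] stands for [h] edges. The parameter [lam]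
    stays free because it will depend on the size of [S]. *)
Lemma subset_tail (p eta lam h : R) (S : {set 'I_n}) :
  0 <= p -> p <= 1 -> 0 <= eta -> eta <= 1 -> 0 <= lam ->
  Prob cl p eta (fun a => 2 * h <= \sum_(i in S) \sum_(j in S) `|Amx a i j|) <=
  expR (p * expR lam * #|S|%:R ^+ 2 - lam * h).
Proof.
move=> p0 p1 e0 e1 l0.
pose s (i j : 'I_n) : R := if (i \in S) && (j \in S) then 1 else 0.
pose c i j := p * expR lam * s i j.
have c0 i j : 0 <= c i j.
  by apply: mulr_ge0; [rewrite mulr_ge0 ?expR_ge0|rewrite /s; case: ifP].
apply: le_trans (_ : expR (\sum_(i : 'I_n) \sum_(j : 'I_n | (i < j)%N) c i j - lam * h) <= _).
  apply: le_trans (chernoff p0 p1 e0 e1 (g := fun i j e => lam * s i j * `|sign_of e|)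
    (lam * h) _).
    apply: (Prob_sub cl p0 p1 e0 e1) => a va; rewrite subset_sum (sum_edges s) // => hh.
    under eq_bigr do under eq_bigr do rewrite -mulrA.
    under eq_bigr do rewrite -mulr_sumr; rewrite -mulr_sumr ler_wpM2l //.
    suff e : \sum_(i : 'I_n) \sum_(j : 'I_n | (i < j)%N) (s i j + s j i) * `|sign_of (a i j)| =
       2 * \sum_(i : 'I_n) \sum_(j : 'I_n | (i < j)%N) s i j * `|sign_of (a i j)|.
      by rewrite e in hh; lra.
    rewrite mulr_sumr; apply: eq_bigr => i _; rewrite mulr_sumr; apply: eq_bigr => j _.
    rewrite /s andbC; ring.
  move=> i j _; apply: le_trans (edge_moment cl _ _ _ p0 e0 e1) _.
  rewrite ler_expR /c /s; case: ifP => _; rewrite ?mulr1 ?mulr0.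
    by rewrite ler_wpM2l // gerBl.
  by rewrite exp.expR0 subrr mulr0.
rewrite ler_expR lerD2r.
apply: le_trans (_ : \sum_i \sum_j c i j <= _).
  apply: ler_sum => i _; rewrite [leRHS](bigID (fun j : 'I_n => (i < j)%N)) /= lerDl.
  by apply: sumr_ge0.
under eq_bigr do rewrite -mulr_sumr; rewrite -mulr_sumr.
have -> : \sum_i \sum_j s i j = #|S|%:R ^+ 2.
  under eq_bigr do under eq_bigr do rewrite -[s _ _]mulr1.
  by rewrite -subset_sum !sumr_const -mulrnA natrM expr2.
by [].
Qed.

(** A single term of [(1 + u) ^ n], which is at most exp(u n), taken at [u = s / n]. Writing [n / s]
    as exp(2 lam) matches the Chernoff parameter used with it. *)
Lemma bin_le_expR (s : nat) (lam : R) : 0 < n%:R :> R -> s%:R * expR (2 * lam) = n%:R ->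
  'C(n, s)%:R <= expR (s%:R * (1 + 2 * lam)) :> R.
Proof.
move=> n0 sn; have [sn'|ns] := leqP s n; last by rewrite bin_small // expR_ge0.
pose u := expR (- (2 * lam)).
have un : u * n%:R = s%:R by rewrite -sn mulrCA -exp.expRD addrC subrr exp.expR0 mulr1.
have u0 : 0 <= u by apply: expR_ge0.
have h : 'C(n, s)%:R * u ^+ s <= expR (s%:R).
  apply: le_trans (_ : (u + 1) ^+ n <= _).
    rewrite addrC exprDn (bigD1 (Ordinal (sn' : s < n.+1)%N)) //= expr1n mul1r mulr_natl lerDl.
    by apply: sumr_ge0 => i _; rewrite expr1n mul1r mulrn_wge0 // exprn_ge0.
  have h1 := expR_ge1Dx u.
  apply: le_trans (_ : expR u ^+ n <= _).
    by rewrite lerXn2r ?nnegrE ?expR_ge0 ?addr_ge0 // addrC.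
  by rewrite -expRM_natl mulrC un.
have -> : expR (s%:R * (1 + 2 * lam)) = expR s%:R * (u ^+ s)^-1.
  by rewrite mulrDr mulr1 exp.expRD; congr (_ * _); rewrite /u -expRM_natl -expRN mulrN opprK.
by rewrite -ler_pdivrMr ?invr_gt0 ?invrK // exprn_gt0 // expR_gt0.
Qed.

(** Sets smaller than [t ^ 6] are left out because the at most [|S| ^ 2] ordered pairs inside them
    already satisfy the density bound. *)
Definition dense_bad (t : R) (a : sample n) : Prop :=
  exists S : {set 'I_n}, [/\ t ^+ 6 <= #|S|%:R, #|S|%:R * t ^+ 6 <= 8 * n%:R &
    2 * (t ^+ 6 * #|S|%:R) <= \sum_(i in S) \sum_(j in S) `|Amx a i j|].

Lemma Prob_dense_bad (p eta t : R) :
  0 <= p -> p <= 1 -> 0 <= eta -> eta <= 1 -> 16 <= t -> p * n%:R <= 2 * t ^+ 8 ->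
  Prob cl p eta (dense_bad t) <= n.+1%:R * expR (- t ^+ 8).
Proof.
move=> p0 p1 e0 e1 t16 pn.
have t0 : 0 < t by lra.
have tp m : 0 < t ^+ m by rewrite exprn_gt0.
pose E (s : 'I_n.+1) (S : {set 'I_n}) (a : sample n) := #|S| = s /\
  [/\ t ^+ 6 <= #|S|%:R, #|S|%:R * t ^+ 6 <= 8 * n%:R &
    2 * (t ^+ 6 * #|S|%:R) <= \sum_(i in S) \sum_(j in S) `|Amx a i j|].
apply: le_trans (_ : Prob cl p eta (fun a => exists s, exists S, E s S a) <= _).
  apply: (Prob_sub cl p0 p1 e0 e1) => a _ [S hS].
  have sn : (#|S| < n.+1)%N by rewrite ltnS -[leqRHS]card_ord max_card.
  by exists (Ordinal sn), S.
apply: le_trans (Prob_exists cl p0 p1 e0 e1 _) _.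
have -> : n.+1%:R * expR (- t ^+ 8) = \sum_(s < n.+1) expR (- t ^+ 8).
  by rewrite sumr_const card_ord mulr_natl.
apply: ler_sum => s _.
apply: le_trans (Prob_exists cl p0 p1 e0 e1 _) _.
have [hs1|hs1] := leP (t ^+ 6) (s%:R); last first.
  rewrite big1 ?expR_ge0 // => S _; apply: Prob_empty => a [-> []].
  by rewrite leNgt hs1.
have [hs2|hs2] := leP (s%:R * t ^+ 6) (8 * n%:R); last first.
  rewrite big1 ?expR_ge0 // => S _; apply: Prob_empty => a [-> []] _.
  by rewrite leNgt hs2.
have s0 : 0 < s%:R :> R by apply: lt_le_trans hs1.
have n0 : 0 < n%:R :> R.
  have := lt_le_trans (mulr_gt0 s0 (tp 6)) hs2; lra.
(* With exp(lam) equal to the square root of [n / s], the mean term is [s * (p n / v)], at most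
   [s * t ^ 6], once [v >= 2 t ^ 2]; the entropy is [s * (1 + 2 lam)]. *)
pose v : R := Num.sqrt (n%:R / s%:R : R).
have v0 : 0 < v by rewrite sqrtr_gt0 divr_gt0.
have v2 : v ^+ 2 = n%:R / s%:R by rewrite sqr_sqrtr // divr_ge0 // ltW.
have sv : s%:R * v ^+ 2 = n%:R by rewrite v2 mulrC divfK // gt_eqF.
have vt : 2 * t ^+ 2 <= v.
  have tt0 : 0 <= 2 * t ^+ 2 by have := tp 2%N; lra.
  have v00 := ltW v0; rewrite -(ler_pXn2r (isT : (0 < 2)%N)) ?nnegrE // v2 ler_pdivlMr //.
  have h : 32 * t ^+ 4 <= t ^+ 6.
    have -> : t ^+ 6 = t ^+ 2 * t ^+ 4 by rewrite -exprD.
    rewrite ler_pM2r // expr2; apply: le_trans (_ : 16 * 16 <= _); first by lra.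
    by apply: ler_pM.
  have -> : (2 * t ^+ 2) ^+ 2 = 4 * t ^+ 4 by ring.
  have : s%:R * (32 * t ^+ 4) <= s%:R * t ^+ 6 by rewrite ler_pM2l.
  lra.
pose lam : R := ln v.
have el : expR lam = v by rewrite lnK ?posrE.
have el2 : expR (2 * lam) = v ^+ 2 by rewrite -[2]/(2%:R) expRM_natl el.
have l4 : 4 <= lam.
  rewrite -ler_expR el; apply: le_trans vt.
  have -> : expR (4 : R) = expR (1 / 2) ^+ 8 by rewrite -expRM_natl; congr expR; field.
  apply: le_trans (_ : 2 ^+ 8 <= _).
    by rewrite lerXn2r ?nnegrE ?expR_ge0 // expR_half_le2.
  have : 16 * 16 <= t ^+ 2 by rewrite expr2; apply: ler_pM.
  lra.
have l0 : 0 <= lam by lra.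
pose phi := expR (s%:R * t ^+ 6 * (1 - lam)).
apply: le_trans (_ : \sum_(S : {set 'I_n} | #|S| == s) phi <= _).
  rewrite [leRHS]big_mkcond; apply: ler_sum => S _; case: eqP => [Ss|Ss]; last first.
    by rewrite Prob_empty // => a [].
  apply: le_trans (_ : expR (p * expR lam * #|S|%:R ^+ 2 - lam * (t ^+ 6 * #|S|%:R)) <= _).
    apply: le_trans (subset_tail (t ^+ 6 * #|S|%:R) S p0 p1 e0 e1 l0).
    by apply: (Prob_sub cl p0 p1 e0 e1) => a _ [_ []].
  rewrite ler_expR Ss el.
  suff : p * v * s%:R ^+ 2 <= s%:R * t ^+ 6 by lra.
  have -> : p * v * s%:R ^+ 2 = s%:R * (p * v * s%:R) by ring.
  rewrite ler_pM2l // -(ler_pM2r v0).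
  have -> : p * v * s%:R * v = p * n%:R by rewrite -sv; ring.
  apply: le_trans pn _; rewrite -[8%N]/(6 + 2)%N exprD mulrCA ler_pM2l //.
rewrite sumr_const -mulr_natl.
have -> : #|[pred S : {set 'I_n} | #|S| == s]| = 'C(n, s).
  rewrite -[n in 'C(n, _)]card_ord -card_draws; apply: eq_card => S.
  by rewrite !inE.
apply: le_trans (_ : expR (s%:R * (1 + 2 * lam)) * phi <= _).
  by rewrite ler_wpM2r ?expR_ge0 // bin_le_expR // el2.
rewrite -exp.expRD ler_expR.
have t1 : 1 <= t by lra.
have t6 : 16 <= t ^+ 6 by apply: le_trans t16 _; rewrite ler_eXnr.
(* The tail [t ^ 6 * (lam - 1)] pays for the entropy and still leaves [t ^ 6] per vertex; as
   [s >= t ^ 6], the total exceeds [t ^ 8]. *)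
have h1 : 1 + 2 * lam + t ^+ 6 * (1 - lam) <= - t ^+ 6.
  have : 0 <= (t ^+ 6 - 16) * (lam - 4) by rewrite mulr_ge0 ?subr_ge0.
  lra.
have -> : s%:R * (1 + 2 * lam) + s%:R * t ^+ 6 * (1 - lam) =
   s%:R * (1 + 2 * lam + t ^+ 6 * (1 - lam)) by ring.
apply: le_trans (_ : s%:R * - t ^+ 6 <= _); first by rewrite ler_pM2l.
rewrite mulrN lerN2; apply: le_trans (_ : t ^+ 6 * t ^+ 6 <= _); last by rewrite ler_pM2r.
by rewrite -exprD ler_weXn2l.
Qed.

End Dense.

(** * Norm of the centered adjacency matrices *)

Section NormBound.
Variables (n k : nat) (cl : 'I_n -> 'I_k).

Lemma norm_edge_mean (p eta : R) (f : 'I_3 -> R) i j :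
  0 <= p -> 0 <= eta -> eta <= 1 -> (forall e, `|f e| <= `|sign_of e|) ->
  `|edge_mean cl p eta f i j| <= p.
Proof.
move=> p0 e0 e1 hf; rewrite /edge_mean.
have [A [B [A0 B0 AB ->]]] := pair_prob_split cl i j p0 e0 e1.
have f0 : f ord0 = 0 by apply/eqP; have := hf ord0; rewrite norm_sign_of normr_le0.
have f1 : `|f (@inord 2 1)| <= 1 by have := hf (@inord 2 1); rewrite norm_sign_of inordK.
have f2 : `|f (@inord 2 2)| <= 1 by have := hf (@inord 2 2); rewrite norm_sign_of inordK.
rewrite f0 mulr0 add0r -AB; apply: le_trans (ler_normD _ _) _.
rewrite !normrM (ger0_norm A0) (ger0_norm B0).
by apply: lerD; rewrite -[leRHS]mulr1 ler_wpM2l.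
Qed.

(** 208 = 120 + 56 + 32: light pairs, edges on heavy pairs, and the mean on heavy pairs. For the
    last, [|Z i * Y j| > t ^ 7] lets the product be replaced by its square over [t ^ 7]. *)
Lemma opnorm_noise_mx (p eta t : R) (f : 'I_3 -> R) (a : sample n) :
  0 <= p -> 0 <= eta -> eta <= 1 -> (forall e, `|f e| <= `|sign_of e|) ->
  16 <= t -> p * n%:R <= 2 * t ^+ 8 -> valid a ->
  (forall i, deg a i <= 4 * t ^+ 8) ->
  ~ light_bad cl p eta (t ^+ 7) f a -> ~ dense_bad t a ->
  opnorm_le (noise_mx cl p eta f a) (208 * t ^+ 7).
Proof.
move=> p0 e0 e1 hf t16 pn va hdeg hl hd.
have t0 : 0 < t by lra.
have t1 : 1 <= t by lra.
have tp m : 0 < t ^+ m by rewrite exprn_gt0.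
have n0 : 0 <= n%:R :> R by [].
apply: opnorm_le_grid => [|z w hz hw]; first by have := tp 7%N; lra.
set Z := gval z in hz *; set Y := gval w in hw *.
set W := noise_mx cl p eta f a.
pose b i j := if `|Z i * Y j| <= t ^+ 7 then Z i * Y j else 0.
pose G i j := `|Amx a i j|.
have [/forallP sa /forallP da] := andP va.
have G0 i j : 0 <= G i j by rewrite /G.
have Gsym i j : G i j = G j i.
  by rewrite /G !mxE; have /forallP/(_ j)/eqP -> := sa i.
have Gd i : G i i = 0 by rewrite /G mxE norm_sign_of (eqP (da i)).
have G1 i j : G i j <= 1 by rewrite /G mxE norm_sign_of lern1; case: (_ == _).
have light : \sum_i \sum_j W i j * b i j <= 120 * t ^+ 7 * n%:R.
  rewrite leNgt; apply/negP => h; apply: hl; exists z, w; split => //.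
  exact: ltW.
have heavy : \sum_i \sum_j (if t ^+ 7 < `|Z i * Y j| then G i j * `|Z i * Y j| else 0) <=
    56 * n%:R * t ^+ 7.
  apply: heavy_pairs => // S S0 Sn.
  have [St|St] := leP (t ^+ 6) #|S|%:R.
    rewrite leNgt; apply/negP => h; apply: hd; exists S; split => //.
    by rewrite mulrA; apply: ltW.
  apply: le_trans (_ : \sum_(i in S) \sum_(j in S) 1 <= _).
    by apply: ler_sum => i _; apply: ler_sum => j _.
  rewrite !sumr_const -mulrnA natrM ler_wpM2r //; have := tp 6%N; lra.
have Wb i j : `|W i j| <= G i j + p.
  rewrite /W mxE; case: eqP => [_|_]; first by rewrite normr0 addr_ge0.
  apply: le_trans (ler_normB _ _) _; apply: lerD; last exact: norm_edge_mean.
  by rewrite /G mxE.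
have mean : \sum_i \sum_j (if t ^+ 7 < `|Z i * Y j| then p * `|Z i * Y j| else 0) <=
    32 * n%:R * t ^+ 7.
  apply: le_trans (_ : \sum_i \sum_j p / t ^+ 7 * (Z i ^+ 2 * Y j ^+ 2) <= _).
    apply: ler_sum => i _; apply: ler_sum => j _.
    have q0 : 0 <= p / t ^+ 7 by rewrite divr_ge0 // ltW.
    case: ifP => [h|_]; last by apply: mulr_ge0 => //; rewrite mulr_ge0 ?sqr_ge0.
    rewrite -mulrA ler_wpM2l // ler_pdivlMl // -exprMn -real_normK ?num_real // expr2.
    by rewrite ler_wpM2r // ltW.
  have -> : \sum_i \sum_j p / t ^+ 7 * (Z i ^+ 2 * Y j ^+ 2) =
     p / t ^+ 7 * ((\sum_i Z i ^+ 2) * (\sum_j Y j ^+ 2)).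
    rewrite mulr_suml mulr_sumr; apply: eq_bigr => i _.
    by rewrite mulr_sumr mulr_sumr.
  apply: le_trans (_ : p / t ^+ 7 * ((4 * n%:R) * (4 * n%:R)) <= _).
    rewrite ler_wpM2l ?divr_ge0 // ?(ltW (tp _)) //.
    by apply: ler_pM => //; apply: sumr_ge0 => i _; rewrite sqr_ge0.
  have -> : p / t ^+ 7 * (4 * n%:R * (4 * n%:R)) = 16 * n%:R * (p * n%:R / t ^+ 7) by ring.
  have -> : 32 * n%:R * t ^+ 7 = 16 * n%:R * (2 * t ^+ 7) by ring.
  rewrite ler_wpM2l ?mulr_ge0 // ler_pdivrMr //; apply: le_trans pn _.
  rewrite -mulrA ler_pM2l // -exprD ler_weXn2l //.
apply: le_trans (_ : \sum_i \sum_j (W i j * b i j +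
    ((if t ^+ 7 < `|Z i * Y j| then G i j * `|Z i * Y j| else 0) +
     (if t ^+ 7 < `|Z i * Y j| then p * `|Z i * Y j| else 0))) <= _).
  apply: ler_sum => i _; apply: ler_sum => j _; rewrite /b.
  case: leP => h; first by rewrite !addr0.
  rewrite mulr0 add0r -mulrDl; apply: le_trans (ler_norm _) _.
  by rewrite normrM ler_wpM2r.
under eq_bigr do rewrite big_split /= big_split /=.
rewrite big_split /= big_split /=; lra.
Qed.

End NormBound.

(** * Perturbation of the Laplacian *)

Section Perturbation.
Variables (n k : nat) (cl : 'I_n -> 'I_k).

Definition edge_of (e : 'I_3) : R := `|sign_of e|.

Lemma edge_mean_sign (p eta : R) i j : edge_mean cl p eta sign_of i j =
  if cl i == cl j then p * (1 - 2 * eta) else - (p * (1 - 2 * eta)).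
Proof.
rewrite /edge_mean sum_pair_prob /sign_of !inordK //= mulr0 add0r.
by case: ifP => _; ring.
Qed.

Lemma edge_mean_edge (p eta : R) i j : edge_mean cl p eta edge_of i j = p.
Proof.
rewrite /edge_mean sum_pair_prob /edge_of !norm_sign_of !inordK //= mulr0 add0r !mulr1.
by case: ifP => _; ring.
Qed.

Definition mean_mx (p eta : R) : 'M[R]_n :=
  \matrix_(i, j) (if i == j then 0 else edge_mean cl p eta sign_of i j).

Lemma Amx_split (p eta : R) (a : sample n) : valid a ->
  Amx a = mean_mx p eta + noise_mx cl p eta sign_of a.
Proof.
move=> /andP[_ /forallP da]; apply/matrixP => i j; rewrite !mxE.
case: eqP => [->|_]; last by rewrite addrC subrK.
by rewrite /sign_of (eqP (da j)) addr0.
Qed.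

Lemma noise_mx_deg (p eta : R) (a : sample n) (j : 'I_n) : valid a ->
  (noise_mx cl p eta edge_of a *m const_mx 1 : 'cV[R]_n) j 0 = deg a j - dbar n p.
Proof.
move=> /andP[_ /forallP da]; rewrite mxE /deg.
under eq_bigr do rewrite [const_mx _ _ _]mxE mulr1.
rewrite [in RHS](bigD1 j) //= [in LHS](bigD1 j) //= !mxE eqxx norm_sign_of (eqP (da j)) !add0r.
under eq_bigr => l lj do rewrite mxE eq_sym (negbTE lj) edge_mean_edge.
under [in RHS]eq_bigr => l lj do rewrite mxE.
rewrite sumrB; congr (_ - _).
by rewrite sumr_const cardC1 card_ord /dbar mulr_natr.
Qed.

End Perturbation.

Lemma laplacian_perturbation : exists2 K : R, 1 < K &
  forall (n k : nat) (cl : 'I_n -> 'I_k) (p eta t gp gm : R) (a : sample n),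
  (2 <= n)%N -> (forall i : 'I_k, exists j, cl j = i) ->
  0 < p -> 0 <= eta -> eta < 1 / 2 -> 16 <= t ->
  dbar n p = t ^+ 8 -> p * n%:R <= 2 * t ^+ 8 ->
  0 <= gp -> 0 <= gm -> gp + gm = t ^+ 7 -> valid a ->
  (forall i, t ^+ 8 / 4 <= deg a i) ->
  opnorm_le (noise_mx cl p eta sign_of a) (208 * t ^+ 7) ->
  opnorm_le (noise_mx cl p eta edge_of a) (208 * t ^+ 7) ->
  opnorm_le (Lgam gp gm a - Lbar cl p eta) (K / t).
Proof.
exists 5000; first by rewrite ltr1n.
move=> n k cl p eta t gp gm a n2 cs p0 e0 e1 t16 hd pn gp0 gm0 gE va hdeg hW hW'.
have t0 : 0 < t by lra.
have tp m : 0 < t ^+ m by rewrite exprn_gt0.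
have n0 : 0 < n%:R :> R by rewrite ltr0n ltnW.
pose d i := deg a i + (gp + gm).
have d4 i : t ^+ 8 / 4 <= d i by rewrite /d gE; have := hdeg i; have := tp 7%N; lra.
have t8 := tp 8%N; have t4 := tp 4%N; have t7 := tp 7%N.
have d0 i : 0 < d i by have := d4 i; lra.
pose q i := Num.sqrt (d i).
have q0 i : 0 < q i by rewrite sqrtr_gt0.
have q2 i : q i ^+ 2 = d i by rewrite sqr_sqrtr // ltW.
have qt i : t ^+ 4 / 2 <= q i.
  have h1 : 0 <= t ^+ 4 / 2 by lra.
  have h2 := ltW (q0 i).
  rewrite -(ler_pXn2r (isT : (0 < 2)%N)) ?nnegrE // q2.
  have -> : (t ^+ 4 / 2) ^+ 2 = t ^+ 8 / 4 by field.
  exact: d4.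
pose Dh : 'M[R]_n := diag_mx (\row_i (q i)^-1).
pose M := mean_mx cl p eta.
pose J : 'M[R]_n := const_mx 1.
pose g : R := (gp - gm) / n%:R.
(* The difference of the inverse square roots of [d] and [D_gamma]. With it the mean part
   telescopes: [M / d - Dh M Dh] is [M Ed / t ^ 4 + Ed M Dh]. *)
pose Ed : 'M[R]_n := diag_mx (\row_i ((t ^+ 4)^-1 - (q i)^-1)).
have hDh : opnorm_le Dh (2 / t ^+ 4).
  apply: opnorm_le_diag => i; rewrite mxE gtr0_norm ?invr_gt0 //.
  have -> : 2 / t ^+ 4 = (t ^+ 4 / 2)^-1 by field; rewrite gt_eqF.
  by rewrite lef_pV2 ?posrE // divr_gt0.
have LE : Lgam gp gm a - Lbar cl p eta =
   (t ^+ 4)^-1 *: (M *m Ed) + Ed *m M *m Dh - Dh *m noise_mx cl p eta sign_of a *m Dh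
   - Dh *m (g *: J) *m Dh.
  have -> : Lbar cl p eta = 1%:M - (t ^+ 8)^-1 *: M.
    apply/matrixP => i j; rewrite LbarE // !mxE edge_mean_sign hd; congr (_ - _).
    by rewrite mulrC.
  have -> : Lgam gp gm a = 1%:M - Dh *m (M + noise_mx cl p eta sign_of a + g *: J) *m Dh.
    by rewrite /Lgam (Amx_split cl p eta va).
  have -> : Ed = (t ^+ 4)^-1 *: 1%:M - Dh.
    rewrite scalemx1 -diag_const_mx -raddfB; congr diag_mx.
    by apply/rowP => i; rewrite !mxE.
  rewrite !mulmxBr !mulmxBl !mulmxDr !mulmxDl -!scalemxAl -!scalemxAr mul1mx mulmx1.
  have -> : (t ^+ 8)^-1 = (t ^+ 4)^-1 * (t ^+ 4)^-1 by field; rewrite gt_eqF.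
  rewrite -scalerA scalerBr.
  set X1 := _ *: (_ *: M); set X2 := _ *: (M *m Dh); set X3 := Dh *m M *m Dh.
  set X4 := Dh *m noise_mx _ _ _ _ _ *m Dh; set X5 := g *: _.
  move: (X5 *m Dh) => X6; clearbody X1 X2 X3 X4 X5.
  by apply/matrixP => i j; rewrite !mxE; ring.
have hn1 : opnorm_le (Dh *m noise_mx cl p eta sign_of a *m Dh) (832 / t).
  have h2 : 0 <= 2 / t ^+ 4 by rewrite divr_ge0 // ltW.
  have -> : 832 / t = 2 / t ^+ 4 * (208 * t ^+ 7) * (2 / t ^+ 4).
    by field; rewrite gt_eqF.
  apply: opnorm_leM => //; first by rewrite mulr_ge0 // mulr_ge0 // ltW.
  exact: opnorm_leM.
have hJ : opnorm_le (g *: J) (t ^+ 7).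
  have hJ1 : opnorm_le J n%:R.
    apply: opnorm_le_frob => //.
    under eq_bigr do under eq_bigr do rewrite mxE expr1n.
    by rewrite !sumr_const card_ord -mulrnA natrM expr2.
  apply: opnorm_leW (opnorm_leZ g hJ1).
  rewrite /g normrM normfV (gtr0_norm n0) divfK ?gt_eqF // ler_norml -gE; lra.
have hn2 : opnorm_le (Dh *m (g *: J) *m Dh) (4 / t).
  have h2 : 0 <= 2 / t ^+ 4 by rewrite divr_ge0 // ltW.
  have -> : 4 / t = 2 / t ^+ 4 * t ^+ 7 * (2 / t ^+ 4) by field; rewrite gt_eqF.
  apply: opnorm_leM => //; first by rewrite mulr_ge0 // ltW.
  exact: opnorm_leM.
pose S := \sum_i ((t ^+ 4)^-1 - (q i)^-1) ^+ 2.
(* Each term is [(d i - t ^ 8) ^ 2] over the square of a denominator at least [t ^ 12 / 2]. Here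
   [d i] includes the regularization [t ^ 7], which raises 208 to 209 in the mean square. *)
have hS : S <= 8 * 209 ^+ 2 * n%:R / t ^+ 10.
  apply: le_trans (_ : \sum_i 4 / t ^+ 24 * (d i - t ^+ 8) ^+ 2 <= _).
    apply: ler_sum => i _.
    have q0' := q0 i; have qt' := qt i.
    have -> : (t ^+ 4)^-1 - (q i)^-1 = (d i - t ^+ 8) / (t ^+ 4 * q i * (q i + t ^+ 4)).
      rewrite -q2; field; rewrite !gt_eqF // addr_gt0 //.
    rewrite expr_div_n mulrC ler_wpM2r ?sqr_ge0 //.
    have -> : 4 / t ^+ 24 = ((t ^+ 4 * (t ^+ 4 / 2) * t ^+ 4) ^+ 2)^-1.
      by field; rewrite gt_eqF.
    have h1 : 0 < t ^+ 4 * (t ^+ 4 / 2) * t ^+ 4 by rewrite !mulr_gt0 ?invr_gt0.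
    have h2 : t ^+ 4 * (t ^+ 4 / 2) * t ^+ 4 <= t ^+ 4 * q i * (q i + t ^+ 4).
      have t42 : 0 < t ^+ 4 / 2 by lra.
      apply: ler_pM; [exact: ltW (mulr_gt0 t4 t42)|exact: ltW|by rewrite ler_pM2l|].
      by rewrite lerDr ltW.
    have h3 := lt_le_trans h1 h2.
    rewrite lef_pV2 ?posrE ?exprn_gt0 // lerXn2r ?nnegrE ?(ltW h1) ?(ltW h3) //.
  rewrite -mulr_sumr.
  pose o : 'cV[R]_n := const_mx 1.
  have no : nsq o = n%:R.
    rewrite nsqE; under eq_bigr do rewrite mxE expr1n.
    by rewrite sumr_const card_ord.
  have hWo : nsq (noise_mx cl p eta edge_of a *m o) <= (208 * t ^+ 7) ^+ 2 * n%:R.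
    rewrite -no -!sqr_euclid -exprMn lerXn2r ?nnegrE ?euclid_ge0 //.
    by rewrite mulr_ge0 ?euclid_ge0 // mulr_ge0 // ltW.
  have hs : \sum_i (d i - t ^+ 8) ^+ 2 <= 2 * 209 ^+ 2 * n%:R * t ^+ 14.
    apply: le_trans (_ : \sum_i (2 * (noise_mx cl p eta edge_of a *m o) i 0 ^+ 2 + 2 * t ^+ 14) <= _).
      apply: ler_sum => i _; rewrite noise_mx_deg // /d gE hd.
      have -> : t ^+ 14 = t ^+ 7 ^+ 2 by rewrite -exprM.
      set x := deg a i; have := sqr_ge0 (x - t ^+ 8 - t ^+ 7); lra.
    rewrite big_split /= -mulr_sumr -nsqE sumr_const card_ord -[X in _ + X <= _]mulr_natr.
    have h14 : 0 <= n%:R * t ^+ 14 by rewrite mulr_ge0 // ltW.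
    have e14 : (208 * t ^+ 7) ^+ 2 * n%:R = 208 ^+ 2 * (n%:R * t ^+ 14) by ring.
    rewrite e14 in hWo.
    have -> : 2 * 209 ^+ 2 * n%:R * t ^+ 14 = 2 * 209 ^+ 2 * (n%:R * t ^+ 14) by ring.
    lra.
  have -> : 8 * 209 ^+ 2 * n%:R / t ^+ 10 = 4 / t ^+ 24 * (2 * 209 ^+ 2 * n%:R * t ^+ 14).
    by field; rewrite gt_eqF.
  by rewrite ler_wpM2l // divr_ge0 // ltW.
have S0 : 0 <= S by apply: sumr_ge0 => i _; rewrite sqr_ge0.
have hMb i j : M i j ^+ 2 <= p ^+ 2.
  rewrite mxE; case: eqP => _; first by rewrite expr0n sqr_ge0.
  rewrite -[leLHS]real_normK ?num_real // lerXn2r ?nnegrE ?(ltW p0) //.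
  apply: norm_edge_mean => //; try lra; exact: ltW.
(* 1254 is 6 * 209: the factor 32 that arises is rounded up to the square 36. *)
have hFS : p ^+ 2 * n%:R * S <= (1254 * t ^+ 3) ^+ 2.
  apply: le_trans (_ : p ^+ 2 * n%:R * (8 * 209 ^+ 2 * n%:R / t ^+ 10) <= _).
    by rewrite ler_wpM2l // mulr_ge0 // ?sqr_ge0.
  have -> : p ^+ 2 * n%:R * (8 * 209 ^+ 2 * n%:R / t ^+ 10) =
     8 * 209 ^+ 2 * ((p * n%:R) ^+ 2 / t ^+ 10) by ring.
  have h : (p * n%:R) ^+ 2 / t ^+ 10 <= 4 * t ^+ 6.
    rewrite ler_pdivrMr //.
    have -> : 4 * t ^+ 6 * t ^+ 10 = (2 * t ^+ 8) ^+ 2 by ring.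
    by rewrite lerXn2r ?nnegrE // mulr_ge0 // ltW.
  have -> : (1254 * t ^+ 3) ^+ 2 = 36 * 209 ^+ 2 * t ^+ 6 by ring.
  have := tp 6%N; lra.
have t3 : 0 <= 1254 * t ^+ 3 by have := tp 3%N; lra.
have hME : opnorm_le (M *m Ed) (1254 * t ^+ 3).
  apply: opnorm_le_frob => //; apply: le_trans hFS.
  rewrite /S mulr_sumr exchange_big /=; apply: ler_sum => j _.
  apply: le_trans (_ : \sum_(i < n) p ^+ 2 * ((t ^+ 4)^-1 - (q j)^-1) ^+ 2 <= _).
    by apply: ler_sum => i _; rewrite mul_mx_diag mxE exprMn [(\row__ _) _ _]mxE ler_wpM2r ?sqr_ge0.
  by rewrite sumr_const card_ord -[leLHS]mulr_natr mulrAC.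
have hEM : opnorm_le (Ed *m M) (1254 * t ^+ 3).
  apply: opnorm_le_frob => //; apply: le_trans hFS.
  rewrite /S mulr_sumr; apply: ler_sum => i _.
  apply: le_trans (_ : \sum_(j < n) p ^+ 2 * ((t ^+ 4)^-1 - (q i)^-1) ^+ 2 <= _).
    by apply: ler_sum => j _; rewrite mul_diag_mx mxE exprMn mulrC [(\row__ _) _ _]mxE ler_wpM2r ?sqr_ge0.
  by rewrite sumr_const card_ord -[leLHS]mulr_natr mulrAC.
rewrite LE.
(* The last summand would only need 4; 406 rounds the total to 5000. *)
have -> : 5000 / t = (t ^+ 4)^-1 * (1254 * t ^+ 3) + 1254 * t ^+ 3 * (2 / t ^+ 4) + 832 / t
    + 406 / t by field; rewrite gt_eqF.
apply: opnorm_leD; last first.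
  apply: opnorm_leN; apply: opnorm_leW hn2; rewrite ler_pM2r ?invr_gt0 //; lra.
apply: opnorm_leD; last exact: opnorm_leN.
apply: opnorm_leD; last exact: opnorm_leM.
by have := opnorm_leZ (t ^+ 4)^-1 hME; rewrite gtr0_norm ?invr_gt0.
Qed.

(** * The exceptional event and the conclusion *)

Definition bad_event (n k : nat) (cl : 'I_n -> 'I_k) (p eta t : R) (a : sample n) : Prop :=
  (light_bad cl p eta (t ^+ 7) sign_of a \/ light_bad cl p eta (t ^+ 7) edge_of a) \/
  (dense_bad t a \/
   ((exists i, 4 * dbar n p <= deg a i) \/ (exists i, deg a i <= dbar n p / 4))).

(** Every contribution is a multiple of [n E] with [E] = exp(- t ^ 8 / 4), the light ones because
    [t ^ 8 <= n]. Half of the exponent absorbs the total factor 6, and the other half exceeds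
    [n p / 16] since [p n <= 2 t ^ 8]. *)
Lemma Prob_bad_event (n k : nat) (cl : 'I_n -> 'I_k) (p eta t : R) :
  0 <= p -> p <= 1 -> 0 <= eta -> eta <= 1 -> (2 <= n)%N -> 16 <= t -> dbar n p = t ^+ 8 ->
  Prob cl p eta (bad_event cl p eta t) <= n%:R * expR (- (n%:R * p / 16)).
Proof.
move=> p0 p1 e0 e1 n2 t16 hd.
have t0 : 0 < t by lra.
have t1 : 1 <= t by lra.
have tp m : 0 < t ^+ m by rewrite exprn_gt0.
have n1 : 2 <= n%:R :> R by rewrite (ler_nat _ 2).
have en : n.-1%:R = n%:R - 1 :> R by rewrite -subn1 natrB // ltnW.
have dE : t ^+ 8 = p * n%:R - p by rewrite -hd /dbar en; ring.
have pn : p * n%:R <= 2 * t ^+ 8.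
  have : 0 <= p * (n%:R - 2) by rewrite mulr_ge0 // subr_ge0.
  by rewrite dE; lra.
have dn : t ^+ 8 <= n%:R.
  have : 0 <= (1 - p) * n%:R by rewrite mulr_ge0 // subr_ge0.
  by rewrite dE; lra.
have pT : p * n%:R <= t ^+ 7 ^+ 2.
  apply: le_trans pn _; rewrite -exprM -[(7 * 2)%N]/(6 + 8)%N exprD ler_pM2r //.
  have : t <= t ^+ 6 by rewrite ler_eXnr.
  lra.
pose E := expR (- (t ^+ 8 / 4)).
have E0 : 0 <= E by apply: expR_ge0.
have nE : E <= n%:R * E by rewrite ler_peMl //; lra.
have b1 f : (forall e, `|f e| <= `|sign_of e|) ->
    Prob cl p eta (light_bad cl p eta (t ^+ 7) f) <= n%:R * E.
  move=> hf; apply: le_trans (Prob_light_bad cl p0 p1 e0 e1 hf (tp 7%N) pT) _.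
  by apply: le_trans nE; rewrite ler_expR lerN2; have := tp 8%N; lra.
have b3 : Prob cl p eta (dense_bad t) <= 2 * (n%:R * E).
  apply: le_trans (Prob_dense_bad cl p0 p1 e0 e1 t16 pn) _.
  rewrite mulrA; apply: ler_pM; rewrite ?expR_ge0 //; first by rewrite -natr1; lra.
  by rewrite ler_expR lerN2; have := tp 8%N; lra.
have b4 : Prob cl p eta (fun a => exists i, 4 * dbar n p <= deg a i) <= n%:R * E.
  apply: le_trans (Prob_exists cl p0 p1 e0 e1 _) _.
  apply: le_trans (_ : \sum_(i < n) E <= _); last by rewrite sumr_const card_ord mulr_natl.
  apply: ler_sum => i _; apply: le_trans (Prob_deg_large cl i p0 p1 e0 e1) _.
  by rewrite ler_expR lerN2 hd; have := tp 8%N; lra.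
have b5 : Prob cl p eta (fun a => exists i, deg a i <= dbar n p / 4) <= n%:R * E.
  apply: le_trans (Prob_exists cl p0 p1 e0 e1 _) _.
  apply: le_trans (_ : \sum_(i < n) E <= _); last by rewrite sumr_const card_ord mulr_natl.
  by apply: ler_sum => i _; apply: le_trans (Prob_deg_small cl i p0 p1 e0 e1) _; rewrite hd.
have OR := Prob_or cl p0 p1 e0 e1.
apply: le_trans (_ : 6 * (n%:R * E) <= _).
  apply: le_trans (OR _ _) _.
  have h1 := OR (light_bad cl p eta (t ^+ 7) sign_of) (light_bad cl p eta (t ^+ 7) edge_of).
  have h2 := OR (dense_bad t) (fun a => (exists i, 4 * dbar n p <= deg a i) \/
     (exists i, deg a i <= dbar n p / 4)).
  have h3 := OR (fun a => exists i, 4 * dbar n p <= deg a i)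
     (fun a => exists i, deg a i <= dbar n p / 4).
  have b1s := b1 sign_of (fun e => lexx _).
  have b1e : Prob cl p eta (light_bad cl p eta (t ^+ 7) edge_of) <= n%:R * E.
    by apply: b1 => e; rewrite /edge_of normr_id.
  lra.
rewrite mulrCA ler_wpM2l //.
apply: le_trans (_ : expR (- (t ^+ 8 / 8)) <= _); last first.
  by rewrite ler_expR lerN2; lra.
have -> : E = expR (- (t ^+ 8 / 8)) * expR (- (t ^+ 8 / 8)).
  by rewrite -exp.expRD; congr expR; field.
rewrite mulrA -[leRHS]mul1r ler_wpM2r ?expR_ge0 // expRN ler_pdivrMr ?expR_gt0 // mul1r.
apply: le_trans (expR_ge1Dx _).
have : t <= t ^+ 8 by rewrite ler_eXnr.
have : 16 * 16 <= t ^+ 2 by rewrite expr2; apply: ler_pM.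
have : t ^+ 2 <= t ^+ 8 by rewrite ler_weXn2l.
lra.
Qed.

(** For [k >= 2] the denominator is at least 16, so the square root of [rho] exceeds [15 / 16] and
    [rho] exceeds [1 / 2]. *)
Lemma rho_balanced (n k : nat) (cl : 'I_n -> 'I_k) : (0 < n)%N -> (2 <= k)%N ->
  Num.sqrt (rho cl) > 1 - 1 / (4 * k%:R * (2 + Num.sqrt k%:R)) ->
  (nmax cl <= 2 * nmin cl)%N.
Proof.
move=> n0 k2 hr.
have k2' : 2 <= k%:R :> R by rewrite (ler_nat _ 2).
have s0 : 0 <= Num.sqrt k%:R :> R by exact: sqrtr_ge0.
have h16 : 16 <= 4 * k%:R * (2 + Num.sqrt k%:R) :> R.
  have : 0 <= (k%:R - 2) * Num.sqrt k%:R :> R by rewrite mulr_ge0 // subr_ge0.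
  lra.
have hs : 15 / 16 < Num.sqrt (rho cl).
  apply: le_lt_trans hr.
  suff : 1 / (4 * k%:R * (2 + Num.sqrt k%:R)) <= 1 / 16 :> R by lra.
  by rewrite !div1r lef_pV2 ?posrE //; lra.
have rho0 : 0 < rho cl by rewrite -sqrtr_gt0; lra.
have rho_gt : 1 / 2 < rho cl.
  rewrite -[rho cl]sqr_sqrtr; last exact: ltW.
  have : 0 < (Num.sqrt (rho cl) - 15 / 16) * (Num.sqrt (rho cl) + 15 / 16).
    by rewrite mulr_gt0 //; lra.
  lra.
have nR : 0 < n%:R :> R by rewrite ltr0n.
have [m0|m0] := posnP (nmax cl); first by rewrite m0.
have mR : 0 < (nmax cl)%:R :> R by rewrite ltr0n.
have rE : rho cl = (nmin cl)%:R / (nmax cl)%:R.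
  rewrite /rho /smin /lmax -/(nmin cl) -/(nmax cl); field.
  by rewrite !gt_eqF.
move: rho_gt; rewrite rE ltr_pdivlMr // => h.
by rewrite -(ler_nat R) natrM; lra.
Qed.

Theorem mainTheorem6 :
  exists C c : R, 1 < C /\ 0 < c /\
  forall (n k : nat) (cl : 'I_n -> 'I_k) (p eta delta r gp gm : R)
         (Rk : 'M[R]_(k, k.-1)),
    (10 <= n)%N -> (2 <= k)%N -> (forall i : 'I_k, exists j, cl j = i) ->
    0 < p -> p <= 1 -> 0 <= eta -> eta < 1 / 2 ->
    Num.sqrt (rho cl) > 1 - 1 / (4 * k%:R * (2 + Num.sqrt k%:R)) ->
    0 < delta -> delta < 1 / 2 -> 1 <= r ->
    p > ((2 * k%:R * (128 * C * r ^+ 2 + 1)) / (delta * (1 - 2 * eta))) ^+ 8 * (2 / n%:R) ->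
    0 <= gp -> 0 <= gm -> gp + gm = powR (dbar n p) (7 / 8) ->
    bottom_eigvecs (Cbar cl p eta) Rk ->
    Prob cl p eta
      (fun a => forall V : 'M[R]_(n, k.-1),
          bottom_eigvecs (Lgam gp gm a) V ->
          exists O : 'M[R]_(k.-1), orthogonal_mx O /\
            opnorm_le (V - Theta cl *m Rk *m O) (2 * delta))
    >= 1 - 7 * expR (- (2 * r)) - 2 / n%:R - n%:R * expR (- (n%:R * p / c)).
Proof.
have [K K1 pert] := laplacian_perturbation.
exists K, 16; split => //.
split; first by rewrite ltr0n.
move=> n k cl p eta delta r gp gm Rk n10 k2 cs p0 p1 e0 e1 hrho d0 d1 r1 hp gp0 gm0 hg hR.
have hbal := rho_balanced (leq_trans (isT : (0 < 10)%N) n10) k2 hrho.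
move: hp {hrho}; set Q : R := (_ / (delta * _)) => hp.
have Qde : delta * (1 - 2 * eta) != 0 ->
    Q * (delta * (1 - 2 * eta)) = 2 * k%:R * (128 * K * r ^+ 2 + 1).
  by move=> h; rewrite divfK.
clearbody Q.
have n2 : (2 <= n)%N by apply: leq_trans n10.
have p0' := ltW p0; have e1' : eta <= 1 by lra.
have n1 : 2 <= n%:R :> R by rewrite (ler_nat _ 2).
have nR : 0 < n%:R :> R by lra.
have k2' : 2 <= k%:R :> R by rewrite (ler_nat _ 2).
have en : n.-1%:R = n%:R - 1 :> R by rewrite -subn1 natrB // ltnW.
have dpos : 0 < dbar n p by exact: dbar_gt0.
pose t : R := powR (dbar n p) (1 / 8).
have t0 : 0 < t by rewrite powR_gt0.
have t8 : dbar n p = t ^+ 8.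
  rewrite -powR_mulrn ?(ltW t0) // /t -powRrM.
  have -> : 1 / 8 * 8%:R = 1 :> R by field.
  by rewrite powRr1 // ltW.
have t7 : gp + gm = t ^+ 7.
  rewrite hg -powR_mulrn ?(ltW t0) // /t -powRrM; congr powR; by field.
clearbody t; move=> {hg}.
have eta0 : 0 < 1 - 2 * eta by lra.
have r2 : 1 <= r ^+ 2 by rewrite exprn_ege1.
have de0 : 0 < delta * (1 - 2 * eta) by rewrite mulr_gt0.
have k0 : 0 < 2 * k%:R :> R by lra.
have Kr : 128 * K <= 128 * K * r ^+ 2 by rewrite ler_peMr //; lra.
have Qge : 2 * k%:R * (128 * K) <= Q * (delta * (1 - 2 * eta)).
  by rewrite Qde ?gt_eqF // ler_pM2l //; lra.
have kK : 512 <= 2 * k%:R * (128 * K).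
  have : 0 <= (k%:R - 2) * (K - 1) by rewrite mulr_ge0 ?subr_ge0 // ltW.
  lra.
have kp : 0 < 2 * k%:R * (128 * K) by lra.
have Q0 : 0 < Q by have := lt_le_trans kp Qge; rewrite pmulr_lgt0.
(* The assumption on [p] says [Q ^ 8 < n p / 2], and [n p / 2] is at most [d = t ^ 8]. *)
have tQ : Q < t.
  rewrite -(ltr_pXn2r (isT : (0 < 8)%N)) ?nnegrE ?(ltW Q0) ?(ltW t0) // -t8.
  have h : Q ^+ 8 * 2 < p * n%:R.
    by move: hp; rewrite mulrA -ltr_pdivlMr ?invr_gt0 // invrK.
  have : 0 <= p * (n%:R - 2) by rewrite mulr_ge0 // subr_ge0.
  by rewrite /dbar en; lra.
move=> {hp Qde}.
have de1 : delta * (1 - 2 * eta) <= 1 / 2.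
  rewrite -[leRHS]mulr1; apply: ler_pM; lra.
have t16 : 16 <= t.
  have : Q * (delta * (1 - 2 * eta)) <= Q * (1 / 2) by rewrite ler_pM2l.
  lra.
have pn : p * n%:R <= 2 * t ^+ 8.
  rewrite -t8 /dbar en; have : 0 <= p * (n%:R - 2) by rewrite mulr_ge0 // subr_ge0.
  lra.
pose good (a : sample n) := forall V : 'M[R]_(n, k.-1),
  bottom_eigvecs (Lgam gp gm a) V -> exists O : 'M[R]_(k.-1), orthogonal_mx O /\
    opnorm_le (V - Theta cl *m Rk *m O) (2 * delta).
have hbad : Prob cl p eta (fun a => ~ good a) <= n%:R * expR (- (n%:R * p / 16)).
  apply: le_trans (Prob_bad_event cl p0' p1 e0 e1' n2 t16 t8).
  apply: (Prob_sub cl p0' p1 e0 e1') => a va hng; apply: contrapT => hb; apply: hng.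
  move: hb => /not_orP[/not_orP[l1 l2] /not_orP[hd /not_orP[hu hl]]].
  have du i : deg a i <= 4 * t ^+ 8.
    by rewrite leNgt; apply/negP => h; apply: hu; exists i; rewrite t8 ltW.
  have dl i : t ^+ 8 / 4 <= deg a i.
    by rewrite leNgt; apply/negP => h; apply: hl; exists i; rewrite t8 ltW.
  have W1 : opnorm_le (noise_mx cl p eta sign_of a) (208 * t ^+ 7) by apply: opnorm_noise_mx.
  have W2 : opnorm_le (noise_mx cl p eta edge_of a) (208 * t ^+ 7).
    by apply: opnorm_noise_mx => // e; rewrite /edge_of normr_id.
  have hE := pert _ _ _ _ _ _ _ _ _ n2 cs p0 e0 e1 t16 t8 pn gp0 gm0 t7 va dl W1 W2.
  move=> V hV.
  have tin : 0 < t^-1 by rewrite invr_gt0.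
  pose g : R := (1 - 2 * eta) / (2 * k%:R).
  have g0 : 0 < g by rewrite divr_gt0 //; lra.
  (* The factor 128 in [C_4] makes the perturbation a small fraction of [delta] times the gap [g],
     small enough that subtracting it from the gap does no harm. *)
  have eg : K / t <= delta * g / 64.
    rewrite ler_pdivrMr //.
    have h1 : 2 * k%:R * (128 * K) <= t * (delta * (1 - 2 * eta)).
      by apply: le_trans Qge _; rewrite ler_pM2r // ltW.
    have -> : delta * g / 64 * t = t * (delta * (1 - 2 * eta)) / (128 * k%:R).
      by rewrite /g; field; rewrite gt_eqF //; lra.
    by rewrite ler_pdivlMr; lra.
  have dg : delta * g <= g / 2 by have := ler_wpM2r (ltW g0) (ltW d1); lra.
  have dg0 : 0 < delta * g by rewrite mulr_gt0.
  have Kt0 : 0 < K / t by rewrite divr_gt0 //; lra.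
  apply: (@cluster_davis_kahan _ _ cl p eta n2 k2 p0 e1 cs Rk (Lgam gp gm a) V (K / t)) => //.
  - exact: ltW.
  - rewrite -/g; lra.
  - exact: ltW.
  - lra.
  - rewrite -/g.
    have : delta * (K / t) <= 1 * (K / t) by rewrite ler_pM2r //; lra.
    lra.
have hsum := Prob_setC cl p eta good.
have h7 : 0 <= expR (- (2 * r)) by apply: expR_ge0.
have h2 : 0 <= 2 / n%:R :> R by rewrite divr_ge0.
rewrite -/good; lra.
Qed.
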